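(* Let $k>0$ be a real number. Let $A$, with domain $D(A)$, be an invertible skew-adjoint operator with bounded inverse on a separable complex Hilbert space $\mathcal H$, and let $\Phi=(\phi_j)_j$ be a Hilbert basis of $\mathcal H$ made of eigenvectors of $A$. Let $B$ be a skew-adjoint operator that is bounded on $\mathcal H$ and bounded on $D(|A|^{k/2})$, with $B(1-A)^{-1}$ compact. Let $s$ be a real number with $0\le s<k$. Then for every $\varepsilon>0$, $L\ge 0$, $n\in\mathbf N$ and $(\psi_j)_{1\le j\le n}\in D(|A|^{k/2})^n$ there exists $N\in\mathbf N$ such that for every $T>0$ and every $u\in\mathcal R((0,T])$, $$|u|((0,T])<L\ \Longrightarrow\ \big\|\Upsilon^u_t(\psi_j)-X^u_{(N)}(t,0)\pi_N\psi_j\big\|_{s/2}<\varepsilon$$ for every $t\in[0,T]$ and every $j=1,\dots,n$.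
   Context: Norms. For $r\ge 0$, $\|\psi\|_{r/2}=\sqrt{\langle|A|^r\psi,\psi\rangle}=\||A|^{r/2}\psi\|$ on $D(|A|^{r/2})$. ''$B$ is bounded on $D(|A|^{k/2})$'' means that $B$ maps $D(|A|^{k/2})$ into itself and is bounded for the norm $\|\cdot\|_{k/2}$. Controls. $\mathcal R((0,T])$ is the set of finite signed (real-valued) Radon measures on $(0,T]$, and $|u|$ is the total variation measure of $u$. Propagator. $\Upsilon^u_t$ is the time-$t$ propagator (from time $0$) of $\frac{d}{dt}\psi=A\psi+uB\psi$ on $\mathcal H$. If $u$ has a density in $L^1((0,T],\mathbf R)$, also denoted $u$, then $\Upsilon^u_t\psi_0=\psi(t)$ is the unique continuous (mild) solution of $\psi(t)=e^{tA}\psi_0+\int_0^t e^{(t-\tau)A}u(\tau)B\psi(\tau)\,d\tau$. For general $u\in\mathcal R((0,T])$ it is the extension by continuity: $\Upsilon^u_t\psi_0=\lim_n\Upsilon^{u_n}_t\psi_0$ in $\mathcal H$ for any sequence of measures $u_n$ on $(0,T]$ with $L^1$ densities such that $\sup_n|u_n|((0,T])<\infty$ and $u_n((0,\tau])\to u((0,\tau])$ for every $\tau\in[0,T]$. Galerkin approximation. $\mathcal L_N=\mathrm{span}(\phi_1,\dots,\phi_N)$, $\pi_N\psi=\sum_{j\le N}\langle\phi_j,\psi\rangle\phi_j$ is the orthogonal projection onto $\mathcal L_N$, $A^{(N)}=\pi_N A|_{\mathcal L_N}$ and $B^{(N)}=\pi_N B|_{\mathcal L_N}$ are the compressions of $A$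 and $B$ to $\mathcal L_N$, and $X^u_{(N)}(t,0)$ is the propagator on $\mathcal L_N$, from time $0$ to time $t$, of $\dot x=(A^{(N)}+uB^{(N)})x$, defined for Radon measure controls $u$ in the same way as $\Upsilon^u_t$. *)

(* Defs.v *)
(* MathComp-Analysis, with the complex numbers R[i] of mathcomp-real-closed. *)
From HB Require Import structures.
From mathcomp Require Import all_boot all_order all_algebra.
From mathcomp Require Import complex.
From mathcomp Require Import all_classical all_reals all_analysis.

Set Implicit Arguments.
Unset Strict Implicit.
Unset Printing Implicit Defensive.

Import Order.TTheory GRing.Theory Num.Theory.
Import numFieldNormedType.Exports.

Local Open Scope classical_set_scope.
Local Open Scope ring_scope.
Local Open Scope complex_scope.

Section ComplexFunctions.
Context {R : realType}.

Definition cexp (z : R[i]) : R[i] :=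
  (expR (complex.Re z))%:C * (cos (complex.Im z) +i* sin (complex.Im z)).

(* The library norm of a complex number or of a vector of a complex normed
   space is an element of R[i] with zero imaginary part. *)
Definition cmod (z : R[i]) : R := complex.Re `|z|.

Definition nrm (H : normedModType R[i]) (x : H) : R := complex.Re `|x|.

End ComplexFunctions.

Section Controls.
Context {R : realType}.

(* The space of finite signed measures on (0, T], as finite signed measures on
   R that do not charge the complement of (0, T]; every finite signed Borel
   measure on the line is Radon. *)
Definition control (T : R) : set ({charge set R -> \bar R}) :=
  [set u | forall E : set R, measurable E -> u E = u (E `&` `]0, T])].

(* |u|, for the Hahn decomposition given by choice; the value on measurable
   sets does not depend on the decomposition. *)
Definition charge_abs (u : {charge set R -> \bar R}) : set R -> \bar R :=
  charge_variation (svalP (cid (svalP (cid (Hahn_decomposition u))))).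

Definition has_L1_density (T : R) (f : R -> R) (u : {charge set R -> \bar R}) :=
  lebesgue_measure.-integrable `]0, T] (EFin \o f) /\
  forall E : set R, measurable E -> E `<=` `]0, T] ->
    u E = (\int[lebesgue_measure]_(x in E) (f x)%:E)%E.

End Controls.

Section HilbertSpace.
Context {R : realType} {H : completeNormedModType R[i]}.

(* Linear in the second argument. With the completeness of H, this says that
   the norm of H is that of a complex Hilbert space. *)
Definition is_inner_product (ip : H -> H -> R[i]) :=
  [/\ forall x a y z, ip x (a *: y + z) = a * ip x y + ip x z,
      forall x y, ip y x = (ip x y)^* &
      forall x, ip x x = `|x| ^+ 2].

Definition separable_space := exists2 S : set H, countable S & dense S.

Definition bounded_operator (f : H -> H) :=
  exists C : R, forall x, nrm (f x) <= C * nrm x.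

Definition compact_operator (f : H -> H) :=
  precompact (f @` [set x | nrm x <= 1]).

(* A possibly unbounded operator is a pair of a domain D and a map f : H -> H
   whose values outside D are irrelevant. *)
Definition linear_operator (D : set H) (f : H -> H) :=
  D 0 /\ forall a x y, D x -> D y ->
    D (a *: x + y) /\ f (a *: x + y) = a *: f x + f y.

(* The inverse of f : D -> H when this map is bijective. *)
Definition op_inv (D : set H) (f : H -> H) : H -> H := 'pinv_(fun=> 0) D f.

Definition invertible_with_bounded_inverse (D : set H) (f : H -> H) :=
  set_bij D setT f /\ bounded_operator (op_inv D f).

Variable ip : H -> H -> R[i].

(* (y, z) belongs to the graph of the adjoint of (D, f). *)
Definition adjoint_graph (D : set H) (f : H -> H) (y z : H) :=
  forall x, D x -> ip y (f x) = ip z x.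

Definition skew_adjoint (D : set H) (f : H -> H) :=
  [/\ linear_operator D f, dense D &
      forall y z, adjoint_graph D f y z <-> D y /\ z = - f y].

(* The span of the first N terms of phi: phi_1, ..., phi_N are
   phi 0, ..., phi N.-1. *)
Definition galerkin_space (phi : nat -> H) (N : nat) : set H :=
  [set v | exists c : 'I_N -> R[i], v = \sum_(j < N) c j *: phi j].

Definition galerkin_proj (phi : nat -> H) (N : nat) (psi : H) : H :=
  \sum_(j < N) ip (phi j) psi *: phi j.

(* In order to cover finite-dimensional spaces as well, a Hilbert basis indexed
   by an initial segment of nat is extended by 0 to the whole of nat. *)
Definition hilbert_basis (phi : nat -> H) :=
  [/\ forall i j, ip (phi i) (phi j) = ((i == j) && (phi i != 0))%:R,
      forall i j, (i <= j)%N -> phi j != 0 -> phi i != 0 &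
      dense [set v | exists N, galerkin_space phi N v]].

(* Since 0 is in D and is mapped to 0, the condition is void at the terms
   phi j = 0 that pad the basis. *)
Definition made_of_eigenvectors (D : set H) (A : H -> H) (phi : nat -> H) :=
  forall j, D (phi j) /\ exists lambda : R[i], A (phi j) = lambda *: phi j.

Section FunctionalCalculus.
Variables (phi : nat -> H) (A : H -> H).

(* When phi is a Hilbert basis made of eigenvectors of A, eigenval j is the
   eigenvalue of phi j, and g(A) is the operator
     g(A) psi = sum_j g(lambda_j) <phi_j, psi> phi_j,
   whose domain is the set of psi for which this orthogonal series converges in
   H, i.e., sum_j |g(lambda_j)|^2 |<phi_j, psi>|^2 is finite. *)
Definition eigenval (j : nat) : R[i] := ip (phi j) (A (phi j)).

Definition calc_series (g : R[i] -> R[i]) (psi : H) : nat -> H :=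
  series (fun j => (g (eigenval j) * ip (phi j) psi) *: phi j).

Definition calc_dom (g : R[i] -> R[i]) : set H :=
  [set psi | cvgn (calc_series g psi)].

Definition calc (g : R[i] -> R[i]) (psi : H) : H :=
  limn (calc_series g psi).

Definition abs_pow (a : R) (z : R[i]) : R[i] := (cmod z `^ a)%:C.

(* The domain of |A|^a and the norm psi |-> | |A|^a psi | on it. *)
Definition dom_abs_pow (a : R) : set H := calc_dom (abs_pow a).

Definition norm_abs_pow (a : R) (psi : H) : R := nrm (calc (abs_pow a) psi).

Definition bounded_on_dom_abs_pow (a : R) (B : H -> H) :=
  (forall psi, dom_abs_pow a psi -> dom_abs_pow a (B psi)) /\
  exists C : R, forall psi, dom_abs_pow a psi ->
    norm_abs_pow a (B psi) <= C * norm_abs_pow a psi.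

(* e^{tA}. *)
Definition exp_op (t : R) : H -> H := calc (fun z => cexp (t%:C * z)).

End FunctionalCalculus.

(* The integral of an H-valued function in the weak sense. The integrands below
   are products of an integrable scalar function and a bounded continuous
   H-valued function, for which this is the Bochner integral. *)
Definition is_integral (D : set R) (f : R -> H) (v : H) :=
  forall chi : H,
    let g_re := fun tau => complex.Re (ip chi (f tau)) in
    let g_im := fun tau => complex.Im (ip chi (f tau)) in
    [/\ lebesgue_measure.-integrable D (EFin \o g_re),
        lebesgue_measure.-integrable D (EFin \o g_im) &
        ip chi v = (\int[lebesgue_measure]_(tau in D) g_re tau)
                   +i* (\int[lebesgue_measure]_(tau in D) g_im tau)].

(* Continuity on [0, T] and, for t in [0, T],
   psi(t) = e^{tA} psi0 + int_0^t e^{(t - tau)A} f(tau) B psi(tau) dtau. *)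
Definition mild_solution (phi : nat -> H) (A B : H -> H) (T : R) (f : R -> R)
    (psi0 : H) (psi : R -> H) :=
  {within `[0, T], continuous psi} /\
  forall t : R, 0 <= t <= T ->
    is_integral `]0, t]
      (fun tau => (f tau)%:C *: exp_op phi A (t - tau) (B (psi tau)))
      (psi t - exp_op phi A t psi0).

(* U T u t psi0 is the value at time t of the propagator, from time 0, of
   psi' = A psi + u B psi on the closed subspace V with Hilbert basis phi, for
   the control u on (0, T]: the mild solution if u has an L^1 density, and the
   extension by continuity to all controls. These two clauses determine U on
   controls, since every control is such a limit of controls with density. *)
Definition is_propagator (V : set H) (phi : nat -> H) (A B : H -> H)
    (U : R -> {charge set R -> \bar R} -> R -> H -> H) :=
  (forall (T : R) (u : {charge set R -> \bar R}) (f : R -> R) (psi0 : H),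
    0 < T -> control T u -> has_L1_density T f u -> V psi0 ->
    mild_solution phi A B T f psi0 (fun t => U T u t psi0)) /\
  (forall (T : R) (u : {charge set R -> \bar R})
      (u_ : nat -> {charge set R -> \bar R}),
    0 < T -> control T u ->
    (forall n, control T (u_ n) /\ exists f, has_L1_density T f (u_ n)) ->
    (exists M : R, forall n, (charge_abs (u_ n) `]0%R, T] <= M%:E)%E) ->
    (forall tau : R, 0 <= tau <= T ->
      u_ n `]0, tau]%classic @[n --> \oo] --> u `]0, tau]%classic) ->
    forall (t : R) (psi0 : H), 0 <= t <= T -> V psi0 ->
      U T (u_ n) t psi0 @[n --> \oo] --> U T u t psi0).

(* The propagator of x' = (A^(N) + u B^(N)) x on the span of phi_1, ..., phi_N,
   which is a Hilbert basis of this subspace made of eigenvectors of A^(N). *)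
Definition is_galerkin_propagator (phi : nat -> H) (A B : H -> H) (N : nat) :=
  is_propagator (galerkin_space phi N)
    (fun j => if (j < N)%N then phi j else 0)
    (galerkin_proj phi N \o A) (galerkin_proj phi N \o B).

End HilbertSpace.

(* Main.v *)
Require Import Defs.
From HB Require Import structures.
From mathcomp Require Import all_boot all_order all_algebra.
From mathcomp Require Import complex.
From mathcomp Require Import all_classical all_reals all_analysis.
From mathcomp Require Import measurable_realfun ring lra.

Set Implicit Arguments.
Unset Strict Implicit.
Unset Printing Implicit Defensive.

Import Order.TTheory GRing.Theory Num.Theory.
Import numFieldNormedType.Exports.

Local Open Scope classical_set_scope.
Local Open Scope ring_scope.
Local Open Scope complex_scope.

(* For a control with a density [f], let [x] be the mild solution and [y] the
   Galerkin solution on the span of the first [N] basis vectors.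
   - The compression of B to this span satisfies the same bound as B in the norm
     of order k/2, so Gronwall bounds [y] in that norm by a constant that depends
     on [N], [T] and [f] only through the L^1 norm of [f].
   - Since B (1 - A)^-1 is compact, splitting the spectrum at a level [r] shows
     that B maps bounded sets of D(|A|^(k/2)) to totally bounded sets, on which
     1 - pi_N tends to 0 uniformly.
   - The error [z := x - y] satisfies
       z(t) = e^(tA) (1 - pi_N) psi
              + int_0^t f e^((t - tau) A) (B z + (1 - pi_N) B y) dtau,
     so Gronwall in H makes it small uniformly. Only the regularity of [y] is
     used; the bound of order k/2 on [x] follows by letting N tend to infinity.
   - The norm of order s/2 of [z] is small by interpolation, and all estimates
     pass to the limit for a general measure [u]. *)

(** * Hilbert space and diagonal operators *)

Section ComplexModulus.
Context {R : realType}.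
Implicit Types (z w : R[i]).

Lemma cmodE z : `|z| = (cmod z)%:C.
Proof. by rewrite /cmod normc_def. Qed.

Lemma cmod_ge0 z : 0 <= cmod z.
Proof. by rewrite -lecR -cmodE normr_ge0. Qed.

Lemma cmodM z w : cmod (z * w) = cmod z * cmod w.
Proof. by apply: complexI; rewrite rmorphM /= -!cmodE normrM. Qed.

Lemma sqr_cmod z : cmod z ^+ 2 = complex.Re z ^+ 2 + complex.Im z ^+ 2.
Proof. by apply: complexI; rewrite rmorphXn /= -cmodE add_Re2_Im2. Qed.

Lemma sqr_cmodE z : (cmod z ^+ 2)%:C = z * z^*%C.
Proof. by rewrite rmorphXn /= -cmodE sqr_normc. Qed.

Lemma cmod_realC (r : R) : cmod r%:C = `|r|.
Proof. by rewrite /cmod normc_def /= expr0n /= addr0 sqrtr_sqr. Qed.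

Lemma cmod0 : cmod (0 : R[i]) = 0.
Proof. by rewrite /cmod normr0. Qed.

Lemma cmod1 : cmod (1 : R[i]) = 1.
Proof. by rewrite /cmod normr1. Qed.

Lemma ler_cmodB z w : cmod (z - w) <= cmod z + cmod w.
Proof. by rewrite -lecR rmorphD /= -!cmodE ler_normB. Qed.

Lemma ReD z w : complex.Re (z + w) = complex.Re z + complex.Re w.
Proof. by case: z; case: w. Qed.

Lemma ReN z : complex.Re (- z) = - complex.Re z.
Proof. by case: z. Qed.

Lemma ImD z w : complex.Im (z + w) = complex.Im z + complex.Im w.
Proof. by case: z; case: w. Qed.

Lemma ImN z : complex.Im (- z) = - complex.Im z.
Proof. by case: z. Qed.

Lemma ReM_real (r : R) z : complex.Re (r%:C * z) = r * complex.Re z.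
Proof. by case: z => a b /=; rewrite mul0r subr0. Qed.

Lemma cmod_cexp_imag (t b : R) : cmod (cexp (t%:C * (0 +i* b))) = 1.
Proof.
rewrite /cexp cmodM /= !mul0r mulr0 subr0 expR0 cmod_realC normr1 mul1r.
apply/eqP; rewrite -(eqrXn2 (_ : 0 < 2)%N) ?cmod_ge0 ?ler01//.
by rewrite sqr_cmod /= expr1n cos2Dsin2.
Qed.

End ComplexModulus.

(** * Real-valued norms on complex normed spaces *)

Section ComplexNorm.
Context {R : realType} {H : normedModType R[i]}.
Implicit Types (x y : H).

Lemma nrmE x : `|x| = (nrm x)%:C.
Proof.
rewrite /nrm; have := ger0_Im (normr_ge0 x).
by case: `|x| => a b /= ->.
Qed.

Lemma nrm_ge0 x : 0 <= nrm x.
Proof. by rewrite -lecR -nrmE normr_ge0. Qed.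

Lemma nrmZ a x : nrm (a *: x) = cmod a * nrm x.
Proof. by apply: complexI; rewrite rmorphM /= -!nrmE -cmodE normrZ. Qed.

Lemma nrmN x : nrm (- x) = nrm x.
Proof. by rewrite /nrm normrN. Qed.

Lemma nrm0 : nrm (0 : H) = 0.
Proof. by rewrite /nrm normr0. Qed.

Lemma ler_nrmD x y : nrm (x + y) <= nrm x + nrm y.
Proof. by rewrite -lecR rmorphD /= -!nrmE ler_normD. Qed.

Lemma nrm_distC x y : nrm (x - y) = nrm (y - x).
Proof. by rewrite -nrmN opprB. Qed.

Lemma ler_nrmB x y : nrm (x - y) <= nrm x + nrm y.
Proof. by rewrite -(nrmN y) ler_nrmD. Qed.

Lemma ler_dist_nrm x y : `|nrm x - nrm y| <= nrm (x - y).
Proof.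
rewrite ler_norml; apply/andP; split.
  rewrite lerNl opprB lerBlDr nrm_distC -{1}(subrK x y); exact: ler_nrmD.
by rewrite lerBlDr -{1}(subrK y x); exact: ler_nrmD.
Qed.

Lemma nrm_eq0 x : nrm x = 0 -> x = 0.
Proof. by move=> h; apply/eqP; rewrite -normr_eq0 nrmE h. Qed.

Lemma cvg_nrmP {I : Type} (F : set_system I) {FF : Filter F} (f : I -> H) x :
  f @ F --> x <-> forall e : R, 0 < e -> \forall i \near F, nrm (x - f i) < e.
Proof.
split.
  move=> /cvgrPdist_lt h e e0.
  have /h : 0 < e%:C by rewrite ltcR.
  by apply: filterS => i; rewrite nrmE ltcR.
move=> h; apply/cvgrPdist_lt => -[a b]; rewrite ltcE /= => /andP[/eqP b0 a0].
by apply: filterS (h _ a0) => i hi; rewrite nrmE b0 ltcR.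
Qed.

Lemma cvg_nrm {I : Type} (F : set_system I) {FF : Filter F} (f : I -> H) x :
  f @ F --> x -> nrm (f i) @[i --> F] --> nrm x.
Proof.
move=> /cvg_nrmP h; apply/cvgrPdist_lt => e /h; apply: filterS => i.
exact: le_lt_trans (ler_dist_nrm _ _).
Qed.

Lemma cvg_nrm_le {I : Type} (F : set_system I) {FF : ProperFilter F}
    (f : I -> H) x (M : R) :
  f @ F --> x -> (\forall i \near F, nrm (f i) <= M) -> nrm x <= M.
Proof. by move=> /cvg_nrm fx; exact: cvgr_to_le. Qed.

End ComplexNorm.

(** * Inner products and truncated diagonal operators *)

Section InnerProduct.
Context {R : realType} {H : completeNormedModType R[i]}.
Variable ip : H -> H -> R[i].
Hypothesis ipP : is_inner_product ip.
Implicit Types (x y z : H) (a : R[i]).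

Lemma ipDr x y z : ip x (y + z) = ip x y + ip x z.
Proof. by case: ipP => l _ _; rewrite -[y]scale1r l mul1r scale1r. Qed.

Lemma ip0r x : ip x 0 = 0.
Proof. by have /esym/eqP := ipDr x 0 0; rewrite addr0 -subr_eq0 addrK => /eqP. Qed.

Lemma ipZr a x y : ip x (a *: y) = a * ip x y.
Proof. by case: ipP => l _ _; rewrite -[a *: y]addr0 l ip0r addr0. Qed.

Lemma ipNr x y : ip x (- y) = - ip x y.
Proof. by rewrite -scaleN1r ipZr mulN1r. Qed.

Lemma ipBr x y z : ip x (y - z) = ip x y - ip x z.
Proof. by rewrite ipDr ipNr. Qed.

Lemma ip_sumr (I : Type) (r : seq I) (P : pred I) (F : I -> H) x :
  ip x (\sum_(i <- r | P i) F i) = \sum_(i <- r | P i) ip x (F i).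
Proof. by elim/big_rec2: _ => [|i u v _ <-]; rewrite ?ip0r ?ipDr. Qed.

Lemma ip_conj x y : ip y x = (ip x y)^*.
Proof. by case: ipP. Qed.

Lemma ip0l x : ip 0 x = 0.
Proof. by rewrite ip_conj ip0r conjc0. Qed.

Lemma ipZl a x y : ip (a *: x) y = a^*%C * ip x y.
Proof. by rewrite ip_conj ipZr rmorphM /= -ip_conj. Qed.

Lemma ipDl x y z : ip (x + y) z = ip x z + ip y z.
Proof. by rewrite ip_conj ipDr rmorphD /= -!ip_conj. Qed.

Lemma ipNl x y : ip (- x) y = - ip x y.
Proof. by rewrite -scaleN1r ipZl rmorphN rmorph1 mulN1r. Qed.

Lemma ip_suml (I : Type) (r : seq I) (P : pred I) (F : I -> H) x :
  ip (\sum_(i <- r | P i) F i) x = \sum_(i <- r | P i) ip (F i) x.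
Proof. by elim/big_rec2: _ => [|i u v _ <-]; rewrite ?ip0l ?ipDl. Qed.

Lemma ipxx x : ip x x = (nrm x ^+ 2)%:C.
Proof. by case: ipP => _ _ ->; rewrite nrmE rmorphXn. Qed.

Lemma Re_ipC x y : complex.Re (ip y x) = complex.Re (ip x y).
Proof. by rewrite ip_conj; case: (ip x y). Qed.

Lemma sqr_nrmD x y :
  nrm (x + y) ^+ 2 = nrm x ^+ 2 + 2 * complex.Re (ip x y) + nrm y ^+ 2.
Proof.
apply: complexI; rewrite -ipxx ipDr !ipDl !ipxx (ip_conj x y).
by case: (ip x y) => a b; apply/eqP; rewrite eq_complex /=; apply/andP; split;
  apply/eqP; ring.
Qed.

(** Cauchy-Schwarz for the real part: expand the square norm of |z| x - |x| z, then divide by the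
    product of the two norms, which is why zero norms are treated apart. *)
Lemma ler_Re_ip x y : `|complex.Re (ip x y)| <= nrm x * nrm y.
Proof.
have h (z : H) : complex.Re (ip x z) <= nrm x * nrm z.
  have [x0|xN0] := eqVneq (nrm x) 0.
    by rewrite (nrm_eq0 x0) ip0l nrm0 mul0r.
  have [z0|zN0] := eqVneq (nrm z) 0.
    by rewrite (nrm_eq0 z0) ip0r nrm0 mulr0.
  have := sqr_ge0 (nrm ((nrm z)%:C *: x + (- (nrm x)%:C) *: z)).
  rewrite sqr_nrmD ipZl ipZr. rewrite conjc_real !nrmZ -rmorphN /= !cmod_realC !normrN.
  rewrite !ger0_norm ?nrm_ge0// !ReM_real => h.
  have x0 : 0 < nrm x by rewrite lt_neqAle eq_sym xN0 nrm_ge0.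
  have z0 : 0 < nrm z by rewrite lt_neqAle eq_sym zN0 nrm_ge0.
  have xz0 : 0 < nrm x * nrm z by rewrite mulr_gt0.
  rewrite -subr_ge0 -(pmulr_rge0 _ xz0) -(pmulr_rge0 _ (_ : 0 < 2))//.
  by apply: le_trans h _; rewrite le_eqVlt; apply/orP; left; apply/eqP; ring.
rewrite ler_norml h andbT lerNl; have := h (- y).
by rewrite ipNr nrmN; case: (ip x y).
Qed.

Lemma nrm_le_Re_ip x (M : R) : 0 <= M ->
  complex.Re (ip x x) <= nrm x * M -> nrm x <= M.
Proof.
move=> M0; rewrite ipxx /= expr2; have [->//|xN0] := eqVneq (nrm x) 0.
by rewrite ler_pM2l // lt_neqAle eq_sym xN0 nrm_ge0.
Qed.

Section Diagonal.
Variable phi : nat -> H.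
Hypothesis phiP :
  forall i j, ip (phi i) (phi j) = ((i == j) && (phi i != 0))%:R.
Implicit Types (g h : nat -> R[i]) (N m : nat) (v w : H).

(** All finite sums of the proof have this form: [g] equal to 1 gives pi_N, the powers |lambda_j|^a
    give a truncation of |A|^a, the phases e^(t lambda_j) one of e^(tA). *)
Definition diag g N v : H := \sum_(j < N) (g j * ip (phi j) v) *: phi j.

Lemma diag_galerkin g N v : galerkin_space phi N (diag g N v).
Proof. by exists (fun j => g j * ip (phi j) v). Qed.

Lemma diag1 N v : diag (fun=> 1) N v = galerkin_proj ip phi N v.
Proof. by apply: eq_bigr => j _; rewrite mul1r. Qed.

Lemma diagE g N v :
  diag g N v = \sum_(0 <= j < N) (g j * ip (phi j) v) *: phi j.
Proof. by rewrite big_mkord. Qed.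

Lemma eq_diag g h N : (forall j, (j < N)%N -> g j = h j) ->
  diag g N =1 diag h N.
Proof. by move=> gh v; apply: eq_bigr => j _; rewrite gh. Qed.

Lemma diagD g N v w : diag g N (v + w) = diag g N v + diag g N w.
Proof.
by rewrite /diag -big_split; apply: eq_bigr => j _; rewrite ipDr mulrDr scalerDl.
Qed.

Lemma diagZ g N a v : diag g N (a *: v) = a *: diag g N v.
Proof.
rewrite /diag scaler_sumr; apply: eq_bigr => j _.
by rewrite ipZr mulrCA scalerA.
Qed.

Lemma diag_scale g a N v : diag (fun j => a * g j) N v = a *: diag g N v.
Proof.
by rewrite -diagZ; apply: eq_bigr => j _; rewrite ipZr mulrCA mulrA.
Qed.

Lemma diag_add g h N v :
  diag (fun j => g j + h j) N v = diag g N v + diag h N v.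
Proof.
rewrite /diag -big_split; apply: eq_bigr => j _ /=.
by rewrite mulrDl scalerDl.
Qed.

Lemma diagN g N v : diag g N (- v) = - diag g N v.
Proof. by rewrite -scaleN1r diagZ scaleN1r. Qed.

Lemma diagB g N v w : diag g N (v - w) = diag g N v - diag g N w.
Proof. by rewrite diagD diagN. Qed.

(** The indices where the basis is padded by 0 contribute nothing, so the orthonormality relations
    can be used as if every [phi j] were a unit vector. *)
Lemma basis_coefK j v : (phi j != 0)%:R * ip (phi j) v = ip (phi j) v.
Proof.
by case: (eqVneq (phi j) 0) => [->|_]; rewrite ?ip0l ?mulr0 ?mul1r.
Qed.

Lemma ip_diag i g N v :
  ip (phi i) (diag g N v) = if (i < N)%N then g i * ip (phi i) v else 0.
Proof.
rewrite /diag ip_sumr; under eq_bigr do rewrite ipZr phiP.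
case: ifPn => iN.
  rewrite (bigD1 (Ordinal iN)) //= eqxx /= big1 ?addr0.
    by rewrite mulrC mulrCA basis_coefK.
  move=> j; rewrite -val_eqE /= eq_sym => /negPf ->.
  by rewrite mulr0.
apply: big1 => j _; rewrite (_ : (i == j) = false) ?mulr0 //.
by apply: contraNF iN => /eqP ->.
Qed.

Lemma diag_diag g h N m v : (m <= N)%N ->
  diag g N (diag h m v) = diag (fun j => g j * h j) m v.
Proof.
move=> mN; rewrite diagE (big_cat_nat (leq0n m) mN) //=.
rewrite [X in _ + X]big1_seq ?addr0 => [|j].
  by rewrite big_mkord; apply: eq_bigr => j _; rewrite ip_diag ltn_ord mulrA.
rewrite mem_index_iota => /andP[_ /andP[mj _]].
by rewrite ip_diag ltnNge mj mulr0 scale0r.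
Qed.

Lemma ip_diagl g N v w :
  ip (diag g N v) w = ip v (diag (fun j => (g j)^*) N w).
Proof.
rewrite /diag ip_suml ip_sumr; apply: eq_bigr => j _.
by rewrite ipZl ipZr rmorphM /= -ip_conj mulrAC.
Qed.

Lemma sqr_nrm_diag g N v :
  nrm (diag g N v) ^+ 2 =
  \sum_(j < N) (cmod (g j) * cmod (ip (phi j) v)) ^+ 2.
Proof.
apply: complexI; rewrite -ipxx {1}/diag ip_suml rmorph_sum /=.
apply: eq_bigr => j _; rewrite ipZl ip_diag ltn_ord -cmodM sqr_cmodE.
by rewrite mulrC.
Qed.

Lemma le_diag g h N m v : (N <= m)%N ->
  (forall j, (j < N)%N -> cmod (g j) <= cmod (h j)) ->
  nrm (diag g N v) <= nrm (diag h m v).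
Proof.
move=> Nm gh; rewrite -(ler_pXn2r (_ : 0 < 2)%N) ?nnegrE ?nrm_ge0//.
rewrite !sqr_nrm_diag.
rewrite -(big_mkord xpredT (fun j => (cmod (g j) * cmod (ip (phi j) v)) ^+ 2)).
rewrite -(big_mkord xpredT (fun j => (cmod (h j) * cmod (ip (phi j) v)) ^+ 2)).
rewrite (big_cat_nat (leq0n N) Nm) //= ler_wpDr ?sumr_ge0 // => [j _|].
  exact: sqr_ge0.
apply: ler_sum_nat => j /= jN.
by rewrite ler_pXn2r ?nnegrE ?mulr_ge0 ?cmod_ge0 // ler_wpM2r ?cmod_ge0 ?gh.
Qed.

Lemma sqr_nrm_proj_orth N v :
  nrm (v - diag (fun=> 1) N v) ^+ 2 = nrm v ^+ 2 - nrm (diag (fun=> 1) N v) ^+ 2.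
Proof.
rewrite sqr_nrmD nrmN ipNr.
have -> : ip v (diag (fun=> 1) N v) = (nrm (diag (fun=> 1) N v) ^+ 2)%:C.
  rewrite -ipxx ip_diagl diag_diag //; congr (ip v _); apply: eq_diag => j _.
  by rewrite conjc1 mul1r.
by rewrite /=; ring.
Qed.

Lemma nrm_proj_le N v : nrm (diag (fun=> 1) N v) <= nrm v.
Proof.
rewrite -(ler_pXn2r (_ : 0 < 2)%N) ?nnegrE ?nrm_ge0//.
by rewrite -subr_ge0 -sqr_nrm_proj_orth sqr_ge0.
Qed.

Lemma nrm_proj_orth_le N v : nrm (v - diag (fun=> 1) N v) <= nrm v.
Proof.
rewrite -(ler_pXn2r (_ : 0 < 2)%N) ?nnegrE ?nrm_ge0//.
by rewrite sqr_nrm_proj_orth lerBlDr lerDl sqr_ge0.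
Qed.

Lemma nrm_proj_orth_noninc N m v : (N <= m)%N ->
  nrm (v - diag (fun=> 1) m v) <= nrm (v - diag (fun=> 1) N v).
Proof.
move=> Nm; rewrite -(ler_pXn2r (_ : 0 < 2)%N) ?nnegrE ?nrm_ge0//.
rewrite !sqr_nrm_proj_orth lerD2l lerN2 ler_pXn2r ?nnegrE ?nrm_ge0//.
exact: le_diag.
Qed.

Lemma diag_contract g N v : (forall j, cmod (g j) <= 1) ->
  nrm (diag g N v) <= nrm v.
Proof.
move=> g1; apply: le_trans (nrm_proj_le N v); apply: le_diag => // j _.
by rewrite (_ : cmod 1 = 1) ?g1 // cmod_realC normr1.
Qed.

Lemma galerkin_space_id N v : galerkin_space phi N v -> diag (fun=> 1) N v = v.
Proof.
case=> c ->; rewrite /diag; apply: eq_bigr => j _.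
rewrite mul1r ip_sumr (bigD1 j) //= big1 ?addr0 => [|i ij].
  rewrite ipZr phiP eqxx /=.
  by case: (eqVneq (phi j) 0) => [->|_]; rewrite ?scaler0 // mulr1.
by rewrite ipZr phiP val_eqE eq_sym (negPf ij) mulr0.
Qed.

Lemma proj_cvg v : dense [set v | exists N, galerkin_space phi N v] ->
  diag (fun=> 1) N v @[N --> \oo] --> v.
Proof.
move=> dphi; apply/cvg_nrmP => e e0.
have := dphi (ball v e%:C); case.
- by exists v; apply: ballxx; rewrite ltcR.
- exact: ball_open.
move=> w [bw [N /galerkin_space_id wN]].
exists N => // m /= Nm; apply: le_lt_trans (nrm_proj_orth_noninc v Nm) _.
(* The projection fixes [w], so [v] may be replaced by [v - w], which is small by density. *)
have -> : v - diag (fun=> 1) N v = (v - w) - diag (fun=> 1) N (v - w).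
  by rewrite diagB wN opprB addrA subrK.
apply: le_lt_trans (nrm_proj_orth_le _ _) _.
by move: bw; rewrite -ball_normE /= nrmE ltcR.
Qed.

Lemma sqr_nrm_diagB g m N v : (m <= N)%N ->
  nrm (diag g N v - diag g m v) ^+ 2 =
  nrm (diag g N v) ^+ 2 - nrm (diag g m v) ^+ 2.
Proof.
move=> mN; have -> : diag g m v = diag (fun=> 1) m (diag g N v).
  rewrite /diag; apply: eq_bigr => j _.
  by rewrite ip_diag (leq_trans _ mN) ?ltn_ord // mul1r.
exact: sqr_nrm_proj_orth.
Qed.

(** The squared norms of the partial sums increase and are bounded, hence converge. By Pythagoras
    their increments are the squared distances between partial sums, which are therefore Cauchy. *)
Lemma diag_bounded_cvg g v (M : R) : (forall N, nrm (diag g N v) <= M) ->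
  cvgn (diag g ^~ v).
Proof.
move=> hM; pose a N : R := nrm (diag g N v) ^+ 2.
have andec : nondecreasing_seq a.
  move=> m N mN; rewrite -subr_ge0 /a -sqr_nrm_diagB //; exact: sqr_ge0.
have aub : has_ubound (range a).
  exists (M ^+ 2) => _ [N _ <-].
  by rewrite ler_pXn2r ?nnegrE ?nrm_ge0 // (le_trans (nrm_ge0 _) (hM N)).
have acvg := nondecreasing_cvgn andec aub.
have ale N : a N <= sup (range a).
  by apply: ub_le_sup => //; exists N.
apply: cauchy_cvg; apply: cauchy_exP => -[e b] /[dup] eb.
rewrite ltcE /= => /andP[/eqP b0 e0].
have /cvgrPdist_lt/(_ (e ^+ 2) (exprn_gt0 _ e0))[N _ hN] := acvg.
exists (diag g N v); exists N => // m /= Nm.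
rewrite -ball_normE /= nrmE b0 ltcR nrm_distC.
rewrite -(ltr_pXn2r (_ : 0 < 2)%N) ?nnegrE ?nrm_ge0 ?(ltW e0)//.
rewrite sqr_nrm_diagB // -/(a m) -/(a N); apply: le_lt_trans (hN N _) => //=.
by rewrite ger0_norm ?subr_ge0 ?ale // lerD2r ale.
Qed.

Lemma le_lim_diag g v N : cvgn (diag g ^~ v) ->
  nrm (diag g N v) <= nrm (limn (diag g ^~ v)).
Proof.
move=> /cvg_nrm/cvgr_to_ge; apply; exists N => // m /= Nm; exact: le_diag.
Qed.

Lemma lim_diag_le g v M : (forall N, nrm (diag g N v) <= M) ->
  nrm (limn (diag g ^~ v)) <= M.
Proof.
by move=> hM; apply: (cvg_nrm_le (diag_bounded_cvg hM)); apply: nearW.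
Qed.

End Diagonal.
End InnerProduct.

(** * Spectral calculus of A and the compactness estimate *)

Section SpectralCalculus.
Context {R : realType} {H : completeNormedModType R[i]}.
Variable ip : H -> H -> R[i].
Hypothesis ipP : is_inner_product ip.
Variable phi : nat -> H.
Hypothesis phiP :
  forall i j, ip (phi i) (phi j) = ((i == j) && (phi i != 0))%:R.
Variables (DA : set H) (A : H -> H).
Hypothesis skewA : skew_adjoint ip DA A.
Hypothesis eigenA : made_of_eigenvectors DA A phi.
Implicit Types (a r t M : R) (m N : nat) (v w : H).

Local Notation lambda := (eigenval ip phi A).
Local Notation proj := (diag ip phi (fun=> 1)).

Definition abs_weight a j : R[i] := abs_pow a (lambda j).

Definition phase t j : R[i] := cexp (t%:C * lambda j).

Lemma calc_seriesE g v :
  calc_series ip phi A g v = (diag ip phi (g \o lambda))^~ v.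
Proof. by apply/funext => N; rewrite /= diagE. Qed.

(** Together with [le_norm_abs_pow], this reduces statements on D(|A|^a) to bounds on finite sums
    that are uniform in the truncation. *)
Lemma dom_abs_pow_bound a v M :
  (forall N, nrm (diag ip phi (abs_weight a) N v) <= M) ->
  dom_abs_pow ip phi A a v /\ norm_abs_pow ip phi A a v <= M.
Proof.
rewrite /dom_abs_pow /norm_abs_pow /calc_dom /calc /= calc_seriesE => hM.
by split; [exact: (diag_bounded_cvg ipP phiP hM)|exact: (lim_diag_le ipP phiP hM)].
Qed.

Lemma le_norm_abs_pow a v N : dom_abs_pow ip phi A a v ->
  nrm (diag ip phi (abs_weight a) N v) <= norm_abs_pow ip phi A a v.
Proof.
rewrite /dom_abs_pow /norm_abs_pow /calc_dom /calc /= calc_seriesE.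
exact: (le_lim_diag ipP phiP).
Qed.

Lemma eigenvalE j : A (phi j) = lambda j *: phi j.
Proof.
have [_ [l Al]] := eigenA j; rewrite /eigenval Al ipZr // phiP eqxx /=.
by case: (eqVneq (phi j) 0) => [->|_]; rewrite ?scaler0 // mulr1.
Qed.

(** Skew-adjointness makes <x, Ax> the opposite of its conjugate. Hence the eigenvalues are
    imaginary and the phases have modulus 1. *)
Lemma skew_Re0 x : DA x -> complex.Re (ip x (A x)) = 0.
Proof.
move=> Dx; case: skewA => _ _ /(_ x (- A x))[_ /(_ (conj Dx erefl)) adj].
have := adj x Dx; rewrite ipNl // => e.
have := Re_ipC ipP x (A x); rewrite e ReN => /eqP.
by rewrite -addr_eq0 -mulr2n mulrn_eq0 /= => /eqP ->; rewrite oppr0.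
Qed.

Lemma Re_eigenval j : complex.Re (lambda j) = 0.
Proof. by apply: skew_Re0; case: (eigenA j). Qed.

Lemma cmod_phase t j : cmod (phase t j) = 1.
Proof.
rewrite /phase; move: (Re_eigenval j); case: (lambda j) => u b /= ->.
exact: cmod_cexp_imag.
Qed.

Lemma nrm_phase t N v : nrm (diag ip phi (phase t) N v) <= nrm v.
Proof. by apply: diag_contract => // j; rewrite cmod_phase. Qed.

Lemma exp_op_cvg t v :
  diag ip phi (phase t) N v @[N --> \oo] --> exp_op ip phi A t v.
Proof.
have := diag_bounded_cvg ipP phiP (fun N => nrm_phase t N v).
by rewrite /exp_op /calc calc_seriesE.
Qed.

Lemma nrm_exp_op t v : nrm (exp_op ip phi A t v) <= nrm v.
Proof.
apply: (cvg_nrm_le (@exp_op_cvg t v)); apply: nearW => N; exact: nrm_phase.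
Qed.

Lemma exp_opB t v w :
  exp_op ip phi A t (v - w) = exp_op ip phi A t v - exp_op ip phi A t w.
Proof.
have h := cvgB (@exp_op_cvg t v) (@exp_op_cvg t w).
apply: (cvg_unique _ (@exp_op_cvg t (v - w))) => //.
rewrite (_ : (diag ip phi (phase t))^~ (v - w) = (fun N =>
  diag ip phi (phase t) N v - diag ip phi (phase t) N w)); first exact: h.
by apply/funext => N; rewrite diagB.
Qed.

Lemma exp_op_fin t N v : proj N v = v ->
  exp_op ip phi A t v = diag ip phi (phase t) N v.
Proof.
move=> vN; apply: (cvg_unique _ (@exp_op_cvg t v)) => //.
apply: cvg_near_cst; exists N => // m /= Nm.
rewrite -{1}vN diag_diag //; apply: eq_diag => j _; exact: mulr1.
Qed.

Lemma exp_op_galerkin t N v :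
  exp_op ip (fun j => if (j < N)%N then phi j else 0)
    (galerkin_proj ip phi N \o A) t v = diag ip phi (phase t) N v.
Proof.
rewrite /exp_op /calc; apply: lim_near_cst => //; exists N => // m /= Nm.
rewrite /calc_series /= /series /= (big_cat_nat (leq0n N) Nm) /=.
rewrite [X in _ + X]big1_seq ?addr0 => [|j]; last first.
  rewrite mem_index_iota => /andP[_ /andP[Nj _]].
  (* The Galerkin basis is 0 from index [N] on, so its exponential series is constant from rank
     [N]. *)
  by rewrite ltnNge Nj scaler0.
rewrite diagE; apply: eq_big_nat => j /= jN; rewrite jN.
rewrite /phase /eigenval jN /= -diag1 ip_diag // jN mul1r.
by congr ((cexp (_ * _) * _) *: _).
Qed.

(** If A d = d, then |d|^2 = Re <d, A d> = 0. This makes [op_inv] a left inverse of 1 - A on the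
    domain. *)
Lemma one_subA_inj : {in DA &, injective (fun x => x - A x)}.
Proof.
move=> x y /set_mem Dx /set_mem Dy e.
case: skewA => -[_ lin] _ _.
have [Dd Ad] := lin (-1) _ _ Dy Dx.
have {}e : A (-1 *: y + x) = -1 *: y + x.
  by rewrite Ad !scaleN1r -[X in _ = - y + X](subrK (A x)) e -addrA addKr.
have := skew_Re0 Dd; rewrite e ipxx //= => /eqP; rewrite sqrf_eq0 => /eqP.
by move/nrm_eq0; rewrite scaleN1r addrC => /eqP; rewrite subr_eq0 => /eqP.
Qed.

Lemma A_diag g N v : DA (diag ip phi g N v) /\
  A (diag ip phi g N v) = diag ip phi (fun j => lambda j * g j) N v.
Proof.
case: skewA => -[D0 lin] _ _; rewrite !diagE.
have A0 : A 0 = 0.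
  by have [_ ] := lin (-1) _ _ D0 D0; rewrite scaler0 addr0 scaleN1r addNr.
elim: N => [|N [IHD IHA]]; first by rewrite !big_geq.
rewrite !big_nat_recr //= ![_ + (_ *: phi N)]addrC.
have [? ->] := lin (g N * ip (phi N) v) _ _ (proj1 (eigenA N)) IHD.
split=> //; rewrite IHA eigenvalE scalerA; congr (_ *: _ + _); ring.
Qed.

Lemma op_inv_diag g N v :
  op_inv DA (fun x => x - A x) (diag ip phi (fun j => (1 - lambda j) * g j) N v)
  = diag ip phi g N v.
Proof.
have [Dv Av] := A_diag g N v.
have -> : diag ip phi (fun j => (1 - lambda j) * g j) N v =
    diag ip phi g N v - A (diag ip phi g N v).
  rewrite Av /diag -sumrB; apply: eq_bigr => j _.
  by rewrite mulrBl mul1r mulrBl scalerBl.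
by rewrite /op_inv pinvKV ?inE //; exact: one_subA_inj.
Qed.

(** The points at distance less than [e] from their N-th projection form an open set. These sets
    increase with N and cover the space, so a compact set containing [S] lies in one of them: the
    one of largest index in a finite subcover. *)
Lemma unif_proj_precompact (S : set H) (e : R) :
  dense [set v | exists N, galerkin_space phi N v] ->
  precompact S -> 0 < e ->
  exists N, forall n, (N <= n)%N -> forall y, S y -> nrm (y - proj n y) <= e.
Proof.
move=> dphi [U SU [cU _]] e0.
pose O N := [set y | nrm (y - proj N y) < e].
have oO N : open (O N).
  rewrite openE => y /= ye; apply/nbhs_ballP.
  have d0 : 0 < e - nrm (y - proj N y) by rewrite subr_gt0.
  exists (e - nrm (y - proj N y))%:C; first by rewrite /= ltcR.
  move=> z; rewrite -ball_normE /= nrmE ltcR nrm_distC => yz.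
  rewrite /O /= -(subrK y z) diagD // opprD addrACA.
  apply: le_lt_trans (ler_nrmD _ _) _; rewrite -ltrBrDr.
  exact: le_lt_trans (nrm_proj_orth_le ipP phiP N _) yz.
have cover : U `<=` \bigcup_(N in setT) O N.
  move=> y _; have /cvg_nrmP/(_ e e0)[N _ hN] := @proj_cvg _ _ _ ipP _ phiP y dphi.
  by exists N => //; exact: (hN N (leqnn N)).
have := cU; rewrite compact_cover => /(_ nat setT O (fun i _ => oO i) cover).
case=> D' _ UD'.
exists (\max_(i <- finmap.enum_fset D') i)%N => n hn y /SU /UD'[i /= iD' yi].
apply: le_trans (ltW yi); apply: nrm_proj_orth_noninc => //.
by apply: leq_trans hn; apply: leq_bigmax_seq.
Qed.

Lemma powR_unbounded a (K : R) : 0 < a -> exists2 r, 1 <= r & K <= r `^ a.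
Proof.
move=> a0; exists (Num.max K 1 `^ a^-1).
  rewrite -[leLHS]/((fun=> 1) a^-1) -powR1 ge0_ler_powR ?nnegrE ?invr_ge0;
  by rewrite ?(ltW a0) ?le_max ?lexx ?ler01 ?orbT.
by rewrite -powRrM mulVf ?gt_eqF // powRr1 ?le_max ?lexx ?ler01 ?orbT.
Qed.

(** The low frequencies of [y] are (1 - A)^-1 of a bounded vector, so B sends them to a fixed
    precompact set; the high ones have norm at most r^(-a) M. It is essential that the rank found
    does not depend on [m], the dimension of the space where [y] lives. *)
Lemma tail_small B a M (d : R) :
  dense [set v | exists N, galerkin_space phi N v] ->
  skew_adjoint ip setT B -> bounded_operator B ->
  compact_operator (B \o op_inv DA (fun x => x - A x)) ->
  0 < a -> 0 < d ->
  exists N, forall n, (N <= n)%N -> forall m y,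
    proj m y = y -> nrm y <= M -> nrm (diag ip phi (abs_weight a) m y) <= M ->
    nrm (B y - proj n (B y)) <= d.
Proof.
move=> dphi [[_ linB] _ _] [CB hCB] cptB a0 d0.
have BD x y : B (x + y) = B x + B y.
  by have [_] := linB 1 x y I I; rewrite !scale1r.
have B0 : B 0 = 0 by have /esym/eqP := BD 0 0; rewrite addr0 -subr_eq0 addrK => /eqP.
have BZ c x : B (c *: x) = c *: B x.
  by have [_] := linB c x 0 I I; rewrite B0 !addr0.
(* The given bounds may be negative, hence the maxima with 0. *)
pose CB' := Num.max CB 0; pose M' := Num.max M 0.
have CB0 : 0 <= CB' by rewrite le_max lexx orbT.
have M0 : 0 <= M' by rewrite le_max lexx orbT.
have {hCB} hCB x : nrm (B x) <= CB' * nrm x.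
  by apply: le_trans (hCB x) _; rewrite ler_wpM2r ?nrm_ge0 // le_max lexx.
(* The cut level is such that B of the high part has norm at most d / 2. *)
have [r r1 hr] := powR_unbounded (2 * CB' * M' / d) a0.
have r0 : 0 < r := lt_le_trans ltr01 r1.
(* Bounds the norm of (1 - A) applied to the low part, since |1 - lambda_j| <= 1 + r there; the
   final 1 keeps [rho] positive. *)
pose rho := (1 + r) * M' + 1.
have r10 : 0 <= 1 + r by rewrite addr_ge0 // ltW.
have rho0 : 0 < rho by rewrite ltr_wpDl // mulr_ge0 // addr_ge0 // ltW.
have [|N hN] := unif_proj_precompact dphi cptB (_ : 0 < d / (2 * rho)).
  by rewrite divr_gt0 // mulr_gt0.
exists N => n Nn m y ym yM yaM.
pose lo j : R[i] := (cmod (lambda j) <= r)%R%:R.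
pose hi j : R[i] := (~~ (cmod (lambda j) <= r)%R)%:R.
have ylh : y = diag ip phi lo m y + diag ip phi hi m y.
  rewrite -{1}ym /diag -big_split; apply: eq_bigr => j _ /=.
  rewrite -scalerDl -mulrDl; congr (_ * _ *: _).
  by rewrite /lo /hi; case: (_ <= _) => /=; rewrite ?addr0 ?add0r.
have ra0 : 0 < r `^ a by rewrite powR_gt0.
have hiM : nrm (diag ip phi hi m y) <= (r `^ a)^-1 * M'.
  have -> : (r `^ a)^-1 = cmod ((r `^ a)^-1)%:C.
    by rewrite cmod_realC ger0_norm // invr_ge0 ltW.
  apply: (@le_trans _ _ (cmod ((r `^ a)^-1)%:C * nrm (diag ip phi (abs_weight a) m y))).
    rewrite -nrmZ -diag_scale //; apply: le_diag => // j _.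
    rewrite cmodM !cmod_realC /hi.
    case: (leP (cmod (lambda j)) r) => /= hj; first by rewrite cmod0 mulr_ge0.
    rewrite cmod1 !ger0_norm ?invr_ge0 ?powR_ge0 //.
    rewrite mulrC ler_pdivlMr // mul1r ge0_ler_powR ?nnegrE ?cmod_ge0 ?ltW //.
  by rewrite ler_wpM2l ?cmod_ge0 // (le_trans yaM) // le_max lexx.
(* Dividing by [rho] places (1 - A) of the low part in the unit ball; the tolerance d / (2 rho)
   becomes d / 2 after scaling back. *)
pose w := diag ip phi (fun j => (1 - lambda j) * lo j) m ((rho^-1)%:C *: y).
have Bw : (B \o op_inv DA (fun x => x - A x)) w =
    (rho^-1)%:C *: B (diag ip phi lo m y).
  by rewrite /= /w op_inv_diag diagZ // BZ.
have w1 : nrm w <= 1.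
  rewrite /w diagZ // nrmZ cmod_realC ger0_norm ?invr_ge0 ?(ltW rho0) //.
  rewrite ler_pdivrMl // mulr1.
  apply: (@le_trans _ _ ((1 + r) * M')); last by rewrite lerDl.
  apply: (@le_trans _ _ (nrm (diag ip phi (fun=> (1 + r)%:C * 1) m y))).
    apply: le_diag => // j _; rewrite mulr1 cmod_realC ger0_norm //.
    rewrite cmodM /lo; case: (leP (cmod (lambda j)) r) => /= hj; last first.
      by rewrite cmod0 mulr0.
    rewrite cmod1 mulr1; apply: le_trans (ler_cmodB _ _) _.
    by rewrite cmod1 lerD2l.
  rewrite diag_scale // nrmZ cmod_realC ger0_norm //.
  by rewrite ler_wpM2l // ym (le_trans yM) // le_max lexx.
rewrite {1 2}ylh BD diagD // opprD addrACA; apply: le_trans (ler_nrmD _ _) _.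
rewrite [leRHS]splitr; apply: lerD.
  have := hN n Nn _ (ex_intro2 _ _ w w1 erefl).
  rewrite Bw diagZ // -scalerBr nrmZ cmod_realC ger0_norm ?invr_ge0 ?(ltW rho0) //.
  rewrite ler_pdivrMl // => /le_trans; apply.
  by rewrite le_eqVlt; apply/orP; left; apply/eqP; field; rewrite gt_eqF.
apply: le_trans (nrm_proj_orth_le ipP phiP _ _) _; apply: le_trans (hCB _) _.
apply: le_trans (ler_wpM2l CB0 hiM) _.
rewrite mulrCA ler_pdivrMl //; move: hr; rewrite ler_pdivrMr //.
by move=> hr; lra.
Qed.

End SpectralCalculus.

(** * Gronwall inequality with an integrable weight *)

Section Gronwall.
Context {R : realType}.
Implicit Types (D : set R) (w h : R -> R).
Local Notation leb := (@lebesgue_measure R).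

Lemma continuous_itv_measurable h (T : R) :
  {within `[0, T], continuous h} -> measurable_fun `]0, T] h.
Proof.
move=> ch; have : measurable_fun `[0, T] h.
  by apply: subspace_continuous_measurable_fun.
apply: measurable_funS => //; exact: subset_itv_oc_cc.
Qed.

Lemma continuous_itv_bounded h (T : R) :
  {within `[0, T], continuous h} -> exists M, forall t, 0 <= t <= T -> `|h t| <= M.
Proof.
move=> ch; have := continuous_compact ch (@segment_compact _ 0 T).
move=> /compact_bounded[M [_ hM]]; exists (M + 1) => t t0T.
by apply: (hM (M + 1)); [rewrite ltrDl|exists t => //; rewrite /= in_itv].
Qed.

Lemma integrable_weight w h (T : R) :
  leb.-integrable `]0, T] (EFin \o w) -> {within `[0, T], continuous h} ->
  leb.-integrable `]0, T] (EFin \o (fun x => w x * h x)).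
Proof.
move=> iw ch; have [M hM] := continuous_itv_bounded ch.
apply: (@integrableMl _ _ _ leb _ (measurable_itv _) _ h iw) => //.
  exact: continuous_itv_measurable.
exists M; split; first exact: num_real.
move=> x Mx y /=; rewrite in_itv /= => /andP[y0 yT].
by apply: le_trans (hM _ _) (ltW Mx); rewrite ltW.
Qed.

(** Solving h <= a + (i / 2) K_i a + h / 2 gives h <= (2 + i K_i) a; the slightly larger factor i +
    1 makes monotonicity immediate. *)
Fixpoint gronwall_cst (i : nat) : R :=
  if i is j.+1 then 2 + i%:R * gronwall_cst j else 1.

Lemma gronwall_cst_ge1 i : 1 <= gronwall_cst i.
Proof.
elim: i => [|i IH] //=; rewrite ler_wpDr ?ler1n // mulr_ge0 //.
exact: le_trans IH.
Qed.

Lemma gronwall_cst_le i : gronwall_cst i <= gronwall_cst i.+1.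
Proof.
rewrite /= -[leLHS]add0r lerD // ler_peMl ?ler1n //.
exact: le_trans (gronwall_cst_ge1 i).
Qed.

(* The constant degrades at each of the levels [i / 2] of the primitive of the
   weight: this replaces the exponential and avoids differentiating that
   primitive, which is only absolutely continuous. *)
Lemma gronwall (L : R) : 0 <= L -> exists2 K : R, 0 <= K &
  forall (T : R) w h (a : R),
  leb.-integrable `]0, T] (EFin \o w) -> (forall x, 0 <= w x) ->
  \int[leb]_(x in `]0, T]) w x <= L ->
  {within `[0, T], continuous h} -> (forall t, 0 <= h t) -> 0 <= a ->
  (forall t, 0 <= t <= T -> h t <= a + \int[leb]_(x in `]0, t]) (w x * h x)) ->
  forall t, 0 <= t <= T -> h t <= K * a.
Proof.
move=> L0; pose n := Num.bound (2 * L); exists (gronwall_cst n).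
  exact: le_trans (gronwall_cst_ge1 n).
move=> T w h a iw w0 wL ch h0 a0 hyp.
(* The primitive of the weight, extended by 0 outside the interval where it is known to be
   integrable. *)
pose theta t := parameterized_integral leb 0 t (w \_ `]0, T]).
have thetaE t : t <= T -> theta t = \int[leb]_(x in `]0, t]) w x.
  move=> tT; rewrite /theta /parameterized_integral -Rintegral_mkcondr.
  congr Rintegral; apply/seteqP; split => x /=; rewrite !in_itv /=.
    by case=> /andP[_ ->] /andP[-> _].
  by move=> /andP[x0 xt]; rewrite x0 xt (le_trans xt tT) ltW.
have iwS s t : 0 <= s -> t <= T -> leb.-integrable `]s, t] (EFin \o w).
  move=> s0 tT; apply: integrableS iw => //.
  by apply: subset_itv; rewrite bnd_simp.
have iwhS s t : 0 <= s -> t <= T ->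
    leb.-integrable `]s, t] (EFin \o (fun x => w x * h x)).
  move=> s0 tT; apply: integrableS (integrable_weight iw ch) => //.
  by apply: subset_itv; rewrite bnd_simp.
have thetaB s t : 0 <= s -> s <= t -> t <= T ->
    \int[leb]_(x in `]s, t]) w x = theta t - theta s.
  move=> s0 st tT; rewrite !thetaE ?(le_trans st tT) //.
  by rewrite Rintegral_itvB ?bnd_simp // iwS.
have theta_le s t : 0 <= s -> s <= t -> t <= T -> theta s <= theta t.
  by move=> s0 st tT; rewrite -subr_ge0 -thetaB // Rintegral_ge0.
have whle s t c : 0 <= s -> s <= t -> t <= T ->
    (forall x, s <= x <= t -> h x <= c) ->
    \int[leb]_(x in `]s, t]) (w x * h x) <= (theta t - theta s) * c.
  move=> s0 st tT hc; rewrite -thetaB // -RintegralZr ?iwS //.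
  apply: le_Rintegral => //; first exact: iwhS.
    under [X in integrable _ _ X]eq_fun do rewrite /= EFinM muleC.
    by apply: integrableZl => //; exact: iwS.
  move=> x /=; rewrite in_itv /= => /andP[sx xt].
  by rewrite ler_wpM2l // hc // xt ltW.
have whB s t : 0 <= s -> s <= t -> t <= T ->
    \int[leb]_(x in `]0, t]) (w x * h x) =
    \int[leb]_(x in `]0, s]) (w x * h x) + \int[leb]_(x in `]s, t]) (w x * h x).
  move=> s0 st tT.
  rewrite -[X in _ = _ + X](Rintegral_itvB (a := BRight 0)) ?bnd_simp //.
    by rewrite addrC subrK.
  exact: iwhS.
have theta0 : theta 0 = 0.
  by rewrite /theta /parameterized_integral set_itv1 Rintegral_set1.
have ctheta : {within `[0, T], continuous theta}.
  rewrite /theta; have [T0|T0] := leP 0 T; last first.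
    rewrite set_itv_ge -?ltNge ?bnd_simp //; exact: continuous_subspace0.
  apply: parameterized_integral_continuous => //.
  rewrite -restrict_EFin; apply/integrable_restrict => //.
  by rewrite setIidr //; exact: subset_itv_oc_cc.
(* Induction on the half-levels of the primitive. *)
have level i t : 0 <= t <= T -> theta t <= i%:R / 2 -> h t <= gronwall_cst i * a.
  elim: i t => [|i IH] t t0T.
    rewrite mul0r mul1r => theta_t; apply: le_trans (hyp t t0T) _.
    (* At level 0 the weight has no mass on []0, t]], and [h] is bounded, so the integral term
       vanishes. *)
    have [M hM] := continuous_itv_bounded ch.
    have /andP[t0 tT] := t0T.
    rewrite gerDl; apply: le_trans (whle 0 t M _ _ _ _) _ => //.
      move=> x /andP[x0 xt]; apply: le_trans (ler_norm _) _; apply: hM.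
      by rewrite x0 (le_trans xt).
    have -> : theta t = 0.
      by apply/eqP; rewrite eq_le theta_t -theta0 theta_le.
    by rewrite theta0 subrr mul0r.
  move=> theta_t; have /andP[t0 tT] := t0T.
  have [|theta_gt] := leP (theta t) (i%:R / 2).
    move=> /(IH _ t0T) /le_trans; apply; rewrite ler_wpM2r //.
    exact: gronwall_cst_le.
  have ct0 (f : R -> R) :
      {within `[0, T], continuous f} -> {within `[0, t], continuous f}.
    by apply: continuous_subspaceW; apply: subset_itv; rewrite bnd_simp.
  (* The time at which the previous level is reached. *)
  have [t1 + theta1] : exists2 t1, t1 \in `[0, t] & theta t1 = i%:R / 2.
    apply: IVT => //; first exact: ct0.
    by rewrite theta0 ge_min le_max divr_ge0 //= (ltW theta_gt) orbT.
  rewrite in_itv /= => /andP[t10 t1t].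
  (* It suffices to bound the maximum of [h] on [[0, t]]. If it is reached after [t1], the weight
     has mass at most 1/2 on []t1, c]], so that part of the integral is at most h(c) / 2 and is
     absorbed in the left-hand side. *)
  have [c + hc] := EVT_max t0 (ct0 _ ch).
  rewrite in_itv /= => /andP[c0 ct].
  have tt : h t <= h c by apply: hc; rewrite in_itv /= t0 lexx.
  apply: le_trans tt _.
  have [ct1|t1c] := leP c t1.
    apply: le_trans (IH c _ _) _; first by rewrite c0 (le_trans ct).
      by rewrite -theta1 theta_le // (le_trans t1t).
    by rewrite ler_wpM2r // gronwall_cst_le.
  have cT : c <= T := le_trans ct tT.
  have := hyp c; rewrite c0 cT => /(_ isT).
  rewrite (whB t1) //; last exact: ltW.
  have h1 := whle 0 t1 (gronwall_cst i * a) (lexx _) t10 (le_trans t1t tT).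
  have {}h1 : \int[leb]_(x in `]0, t1]) (w x * h x) <=
      i%:R / 2 * (gronwall_cst i * a).
    move: h1; rewrite theta0 subr0 theta1; apply => x /andP[x0 xt1].
    apply: IH; first by rewrite x0 (le_trans xt1) // (le_trans t1t).
    by rewrite -theta1 theta_le // (le_trans t1t).
  have h2 := whle t1 c (h c) t10 (ltW t1c) cT.
  have {}h2 : \int[leb]_(x in `]t1, c]) (w x * h x) <= 2^-1 * h c.
    apply: le_trans (h2 _) _ => [x /andP[t1x xc]|].
      by apply: hc; rewrite in_itv /= (le_trans t10) // (le_trans xc).
    rewrite ler_wpM2r // theta1; have := theta_le c t c0 ct tT.
    move: theta_t; rewrite -natr1; lra.
  have K0 : 0 <= gronwall_cst i * a.
    by rewrite mulr_ge0 // (le_trans _ (gronwall_cst_ge1 i)).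
  by rewrite -natr1; nra.
move=> t t0T; apply: level => //.
have /andP[t0 tT] := t0T.
(* By the choice of [n] the total mass L is below n / 2, so level [n] covers all of [[0, T]]. *)
have -> : n%:R / 2 = (2 * L - (2 * L - n%:R)) / 2 :> R by lra.
have h1 := theta_le t T t0 tT (lexx _).
have h2 := archi_boundP (_ : 0 <= 2 * L); move: wL; rewrite -thetaE //.
have {}h2 : 2 * L < n%:R by apply: h2; rewrite mulr_ge0.
lra.
Qed.

End Gronwall.

(** * Approximation of controls by integrable densities *)

Section Smearing.
Context {R : realType}.
Local Notation leb := (@lebesgue_measure R).
Implicit Types (nu : {finite_measure set (measurableTypeR R) -> \bar R}).
Implicit Types (E : set (measurableTypeR R)) (h : R).

Local Notation fwd h s := `](s : R), (s : R) + h]%classic.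
Local Notation bwd h x := `[(x : R) - h, (x : R)[%classic.

(** Its sections are the forward windows []s, s + h]] and the backward windows [[x - h, x[]; Tonelli
    on this set exchanges the two. *)
Definition window h : set (measurableTypeR R * measurableTypeR R) :=
  [set p | p.1 < p.2 <= p.1 + h].

Lemma measurable_window h : measurable (window h).
Proof.
rewrite (_ : window h = [set p | p.1 < p.2] `&` [set p | p.2 <= p.1 + h]).
  apply: measurableI.
    have := @measurable_fun_ltr _ _ R setT (fst : R * R -> R) snd
      measurable_fst measurable_snd measurableT [set true].
    rewrite setTI; apply => //.
  have := @measurable_fun_ler _ _ R setT (snd : R * R -> R) (fun p => p.1 + h)
    measurable_snd _ measurableT [set true].
  rewrite setTI; apply => //; exact: measurable_funD.
by apply/seteqP; split => x; rewrite /window /=; [move=> /andP[]|move=> [-> ->]].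
Qed.

Lemma measurable_window_measure nu h :
  measurable_fun setT (fun s : R => nu (fwd h s)).
Proof.
have := measurable_fun_xsection nu (measurable_window h).
congr (measurable_fun setT _); apply/funext => s /=; congr (nu _).
by apply/seteqP; split => x /=; rewrite /xsection /= inE /window /= in_itv.
Qed.

Lemma ysection_window E h (x : R) :
  ysection (window h `&` (E `*` setT)) x = E `&` (bwd h x).
Proof.
apply/seteqP; split => s /=; rewrite /ysection /window /= inE /= in_itv /=.
  by move=> [/andP[sx xs] [Es _]]; split => //; rewrite sx lerBlDr xs.
by move=> [Es /andP[xs sx]]; rewrite sx -lerBlDr xs.
Qed.

Lemma measurable_leb_window E h : measurable E ->
  measurable_fun setT (fun x => leb (E `&` (bwd h x))).
Proof.
move=> mE; have mA : measurable (window h `&` (E `*` setT)).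
  by apply: measurableI; [exact: measurable_window|exact: measurableX].
have := measurable_fun_ysection leb mA.
congr (measurable_fun setT _); apply/funext => x /=.
by rewrite ysection_window.
Qed.

Lemma window_fubini nu E h : measurable E ->
  (\int[leb]_(s in E) nu (fwd h s) =
   \int[nu]_x leb (E `&` (bwd h x)))%E.
Proof.
move=> mE; pose A := window h `&` (E `*` setT).
have mA : measurable A.
  by apply: measurableI; [exact: measurable_window|exact: measurableX].
have FE s : fubini_F nu (EFin \o \1_A) s = nu (xsection A s).
  by rewrite (indic_fubini_tonelli_FE nu mA).
have GE x : fubini_G leb (EFin \o \1_A) x = leb (ysection A x).
  by rewrite (indic_fubini_tonelli_GE leb mA).
transitivity (\int[leb]_s fubini_F nu (EFin \o \1_A) s)%E.
  rewrite integral_mkcond; apply: eq_integral => s _; rewrite FE patchE.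
  case: ifPn => [/set_mem Es|]; last rewrite notin_setE => nEs; last first.
    rewrite (_ : xsection A s = set0) ?measure0 //.
    by apply/seteqP; split => x //=; rewrite /xsection /= inE /A /= => -[_ [/nEs]].
  congr (nu _); apply/seteqP; split => x /=;
    rewrite /xsection /A /window /= inE /= in_itv /=; first by split.
  by case.
rewrite (indic_fubini_tonelli leb nu mA); apply: eq_integral => x _.
by rewrite GE ysection_window.
Qed.

Lemma leb_window h (x : R) : 0 <= h -> leb (bwd h x) = h%:E.
Proof.
move=> h0; rewrite lebesgue_measure_itv /= lte_fin.
case: ltP => xh; first by rewrite -EFinB opprB addrCA subrr addr0.
by congr EFin; lra.
Qed.

Lemma leb_window_le E h (x : R) : 0 <= h -> measurable E ->
  (leb (E `&` (bwd h x)) <= h%:E)%E.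
Proof.
move=> h0 mE; rewrite -(leb_window x h0); apply: le_measure; rewrite ?inE //.
exact: measurableI.
Qed.

Lemma window_mass_le nu E h : 0 <= h -> measurable E ->
  (\int[leb]_(s in E) nu (fwd h s) <= h%:E * nu setT)%E.
Proof.
move=> h0 mE; rewrite window_fubini // -integral_cst //.
apply: ge0_le_integral => //; first exact: measurable_leb_window.
by move=> x _; exact: leb_window_le.
Qed.

(** By Tonelli the left side is the nu-integral of the fraction of [[x - h, x[] lying in []0, t]],
    with h = 1 / (n + 1). This fraction is at most 1 and tends to the indicator of []0, t]] at every
    x, including x = t since the window lies to the left of x; dominated convergence applies. *)
Lemma window_cvg nu (t : R) :
  ((n.+1%:R)%:E * \int[leb]_(s in `]0%R, t]) nu (fwd n.+1%:R^-1 s))%E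
    @[n --> \oo] --> nu `]0%R, t]%classic.
Proof.
have inv_ge0 n : 0 <= (n.+1%:R^-1 : R) by rewrite invr_ge0.
have mI : measurable (`]0%R, t]%classic : set (measurableTypeR R)).
  exact: measurable_itv.
pose g n x := ((n.+1%:R)%:E * leb (`]0%R, t]%classic `&` (bwd n.+1%:R^-1 x)))%E.
have mg n : measurable_fun setT (g n).
  by apply: measurable_funeM; exact: measurable_leb_window.
have := @dominated_convergence _ _ _ nu setT measurableT g
  (EFin \o \1_(`]0%R, t]%classic)) (cst 1%E) mg.
case.
- by apply/measurable_EFinP; exact: measurable_indic.
- apply: aeW => x _; apply: cvg_near_cst.
  (* For x > t the window leaves []0, t]] once h < x - t; for x <= 0 it never meets it; for 0 < x <=
     t it lies inside once h < x. *)
  rewrite /g /= indicE; have [xt|xt] := leP x t; last first.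
    have x_t : 0 < x - t by rewrite subr_gt0.
    have := near_infty_natSinv_lt (PosNum x_t).
    apply: filterS => n; rewrite -[X in _ < X]/(x - t) => hn.
    rewrite [X in leb X](_ : _ = set0); last first.
      apply/seteqP; split => s //=; rewrite !in_itv /= => -[/andP[_ st] /andP[xs _]].
      move: hn xs; move: (_^-1) => d hn xs; lra.
    by rewrite measure0 mule0 memNset //= in_itv /= leNgt xt andbF.
  have [x0|x0] := leP x 0.
    apply: nearW => n; rewrite [X in leb X](_ : _ = set0); last first.
      apply/seteqP; split => s //=; rewrite !in_itv /= => -[/andP[s0 _] /andP[_ sx]].
      lra.
    by rewrite measure0 mule0 memNset //= in_itv /= ltNge x0.
  have := near_infty_natSinv_lt (PosNum x0); apply: filterS => n.
  rewrite -[X in _ < X]/x => hn.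
  rewrite setIidr ?leb_window //.
    by rewrite -EFinM divff ?pnatr_eq0 // mem_set //= in_itv /= x0 xt.
  move=> s /=; rewrite !in_itv /= => /andP[xs sx].
  by move: hn xs; move: (_^-1) => d hn xs; apply/andP; split; lra.
- exact: finite_measure_integrable_cst.
- apply: aeW => x n _; rewrite gee0_abs /g ?mule_ge0 //=.
  apply: le_trans (lee_wpmul2l _ (leb_window_le x (inv_ge0 n) mI)) _ => //.
  by rewrite -EFinM divff ?pnatr_eq0.
move=> _ _; rewrite integral_indic // setIT.
apply: cvg_trans; apply: near_eq_cvg; apply: nearW => n /=.
rewrite window_fubini // -ge0_integralZl //=.
exact: measurable_leb_window.
Qed.

End Smearing.

(* The library puts two measurable structures on [R], with the same measurable
   sets but different displays: the Lebesgue measure lives on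
   [measurableTypeR R], the controls live on [R]. *)
Section Displays.
Context {R : realType}.

Definition to_borel (nu : {finite_measure set R -> \bar R}) :
  set (measurableTypeR R) -> \bar R := nu.

HB.instance Definition _ nu := isMeasure.Build _ (measurableTypeR R) R
  (to_borel nu) (measure0 nu) (measure_ge0 nu)
  (@measure_semi_sigma_additive _ _ _ nu).

HB.instance Definition _ nu := @Measure_isFinite.Build _ (measurableTypeR R) R
  (to_borel nu) (@fin_num_measure _ _ _ nu).

Definition of_borel (v : {charge set (measurableTypeR R) -> \bar R}) :
  set R -> \bar R := v.

HB.instance Definition _ v := isCharge.Build _ R R (of_borel v)
  (charge0 v) (@fin_num_measure _ _ _ v) (@charge_semi_sigma_additive _ _ _ v).

End Displays.

(** * Densities as controls, and approximation of a general control *)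

Section ControlApproximation.
Context {R : realType}.
Local Notation leb := (@lebesgue_measure R).
Implicit Types (u : {charge set R -> \bar R}) (T : R).

Lemma charge_absE u : exists P N (uPN : hahn_decomposition u P N),
  charge_abs u = charge_variation uPN.
Proof. by eexists; eexists; eexists; reflexivity. Qed.

Lemma jordan_pos_restr u P N (uPN : hahn_decomposition u P N) E :
  measurable E -> jordan_pos uPN E = u (E `&` P).
Proof. by move=> mE; rewrite jordan_posE cjordan_posE /crestr0 mem_set. Qed.

Lemma jordan_neg_restr u P N (uPN : hahn_decomposition u P N) E :
  measurable E -> jordan_neg uPN E = (- u (E `&` N))%E.
Proof. by move=> mE; rewrite jordan_negE cjordan_negE /crestr0 mem_set. Qed.

(** The control is the charge induced by [f] extended by 0. On each of the two Hahn sets its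
    variation is, up to sign, an integral of [f], hence at most the integral of |f|; the two sets
    form a partition. *)
Lemma L1_control T (f : R -> R) : leb.-integrable `]0, T] (EFin \o f) ->
  exists u, [/\ control T u, has_L1_density T f u &
    (charge_abs u `]0%R, T]%classic <=
       \int[leb]_(x in `]0%R, T]) `|(f x)%:E|)%E].
Proof.
move=> intf; have mI : measurable (`]0, T]%classic : set (measurableTypeR R)).
  exact: measurable_itv.
have intg : leb.-integrable setT ((EFin \o f) \_ `]0, T]).
  by apply/(integrable_mkcond (mu := leb) (EFin \o f) mI).
pose u : {charge set R -> \bar R} := of_borel (induced_charge intg).
have uE (E : set R) : u E = (\int[leb]_(x in E `&` `]0%R, T]) (f x)%:E)%E.
  by rewrite integral_mkcondr.
exists u; split.
- by move=> E mE; rewrite !uE -setIA setIid.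
- by split=> // E mE EI; rewrite uE setIidl.
have [P [N [uPN ->]]] := charge_absE u.
have [[mP _] [mN _] PUN PIN] := uPN.
rewrite /charge_variation jordan_pos_restr // jordan_neg_restr //.
rewrite !uE !(setIAC _ _ `]0, T]%classic) setIid.
have absu (Q : set (measurableTypeR R)) : measurable Q ->
    (`| \int[leb]_(x in `]0%R, T] `&` Q) (f x)%:E | <=
     \int[leb]_(x in `]0%R, T] `&` Q) `|(f x)%:E|)%E.
  move=> mQ; apply: le_abse_integral; first exact: measurableI.
  apply: measurable_funS (measurable_int _ intf) => //; exact: subIsetl.
rewrite -[X in (\int[_]_(_ in X) `|_|)%E]setIT -PUN setIUr.
rewrite ge0_integral_setU //=; [| exact: measurableI | exact: measurableI | |].
- apply: leeD; first exact: le_trans (lee_abs _) (absu P mP).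
  by apply: le_trans (lee_abs _) _; rewrite abseN; exact: absu.
- rewrite -setIUr PUN setIT; apply/measurable_EFinP.
  have /measurable_EFinP mf := @measurable_int _ _ _ leb _ _ intf.
  exact: measurableT_comp mf.
- apply/disj_setPS => x [[_ Px] [_ Nx]]; rewrite -PIN; by split.
Qed.

(* The density of the convolution of [nu] with the uniform law on
   [[- 1 / n.+1, 0]]. Mass is moved to the left only, so that the mass of
   [`]0, t]] converges for every [t], including the atoms of [nu]. *)
Section Smear.
Variable nu : {finite_measure set (measurableTypeR R) -> \bar R}.
Implicit Types (n : nat) (E : set (measurableTypeR R)).

Definition smear n (s : R) : R :=
  n.+1%:R * fine (nu `]s, s + n.+1%:R^-1]%classic).

Lemma smear_ge0 n s : 0 <= smear n s.
Proof. by rewrite mulr_ge0 // fine_ge0. Qed.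

Lemma EFin_smear n s :
  (smear n s)%:E = (n.+1%:R%:E * nu `]s, (s + n.+1%:R^-1)%R]%classic)%E.
Proof. by rewrite EFinM fineK // fin_num_measure. Qed.

Lemma measurable_smear n E : measurable_fun E (EFin \o smear n).
Proof.
apply: measurable_funTS; rewrite (_ : EFin \o _ = fun s : R =>
  (n.+1%:R%:E * nu `]s, (s + n.+1%:R^-1)%R]%classic)%E); last first.
  by apply/funext => s; exact: EFin_smear.
by apply: measurable_funeM; exact: measurable_window_measure.
Qed.

Lemma integral_smear n E : measurable E ->
  (\int[leb]_(s in E) (smear n s)%:E =
   n.+1%:R%:E * \int[leb]_(s in E) nu `](s : R), ((s : R) + n.+1%:R^-1)%R]%classic)%E.
Proof.
move=> mE; under eq_integral do rewrite EFin_smear.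
rewrite ge0_integralZl //.
by apply: measurable_funTS; exact: measurable_window_measure.
Qed.

Lemma smear_mass n E : measurable E ->
  (\int[leb]_(s in E) (smear n s)%:E <= nu setT)%E.
Proof.
move=> mE; rewrite integral_smear //.
have h0 : 0 <= (n.+1%:R^-1 : R) by rewrite invr_ge0.
apply: le_trans (lee_wpmul2l _ (window_mass_le nu h0 mE)) _ => //.
by rewrite muleA -EFinM divff ?pnatr_eq0 // mul1e.
Qed.

Lemma integrable_smear n E : measurable E -> leb.-integrable E (EFin \o smear n).
Proof.
move=> mE; apply/integrableP; split; first exact: measurable_smear.
under eq_integral do rewrite /= ger0_norm ?smear_ge0 //.
by apply: le_lt_trans (smear_mass n mE) _; rewrite ltey_eq fin_num_measure.
Qed.

Lemma smear_cvg t : (\int[leb]_(s in `]0%R, t]) (smear n s)%:E)%E @[n --> \oo] -->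
  nu `]0, t]%classic.
Proof.
apply: cvg_trans (@window_cvg R nu t); apply: near_eq_cvg; apply: nearW => n.
by rewrite -integral_smear.
Qed.

End Smear.

(** The positive and negative Jordan parts are smeared separately and subtracted. Their total masses
    add up to that of |u|, which bounds both the L^1 norms and the variations by [L]. *)
Lemma control_approx T (L : R) u : 0 < T -> control T u ->
  (charge_abs u `]0%R, T]%classic <= L%:E)%E ->
  exists (u_ : nat -> {charge set R -> \bar R}) (f_ : nat -> R -> R),
  [/\ forall n, control T (u_ n),
      forall n, has_L1_density T (f_ n) (u_ n),
      forall n, \int[leb]_(x in `]0, T]) `|f_ n x| <= L,
      forall n, (charge_abs (u_ n) `]0%R, T]%classic <= L%:E)%E &
      forall t, 0 <= t <= T ->
        u_ n `]0, t]%classic @[n --> \oo] --> u `]0, t]%classic].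
Proof.
move=> T0 cu uL; have [P [N [uPN absu]]] := charge_absE u.
have mI t : measurable (`]0, t]%classic : set (measurableTypeR R)).
  exact: measurable_itv.
have [[mP _] [mN _] _ _] := uPN.
pose up := to_borel (jordan_pos uPN); pose un := to_borel (jordan_neg uPN).
pose f_ n s := smear up n s - smear un n s.
have intf n : leb.-integrable `]0, T] (EFin \o f_ n).
  exact: (integrableB (mI T) (integrable_smear up n (mI T))
    (integrable_smear un n (mI T))).
(* A control does not charge the complement of []0, T]], so the full mass of each Jordan part is the
   one counted in |u|([]0, T]]). *)
have upT : up setT = u (`]0, T]%classic `&` P).
  transitivity (jordan_pos uPN setT) => //.
  by rewrite jordan_pos_restr // setTI cu // setIC.
have unT : un setT = (- u (`]0%R, T]%classic `&` N))%E.
  transitivity (jordan_neg uPN setT) => //.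
  by rewrite jordan_neg_restr // setTI cu // setIC.
have upun : (up setT + un setT <= L%:E)%E.
  apply: le_trans uL; rewrite absu /charge_variation upT unT.
  by rewrite jordan_pos_restr // jordan_neg_restr.
have fL n : (\int[leb]_(x in `]0%R, T]) `|(f_ n x)%:E| <= L%:E)%E.
  apply: le_trans upun.
  apply: le_trans (leeD (smear_mass up n (mI T)) (smear_mass un n (mI T))).
  rewrite -ge0_integralD //=; [|by move=> x _; rewrite lee_fin smear_ge0| |
    by move=> x _; rewrite lee_fin smear_ge0|]; try exact: measurable_smear.
  apply: ge0_le_integral => //=.
  - have /measurable_EFinP mf := @measurable_int _ _ _ leb _ _ (intf n).
    by apply/measurable_EFinP; exact: measurableT_comp mf.
  - by apply: emeasurable_funD; exact: measurable_smear.
  - move=> x _; rewrite -EFinD lee_fin; apply: le_trans (ler_normB _ _) _.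
    by rewrite !ger0_norm ?smear_ge0.
have /choice[u_ hu] := fun n => L1_control (intf n).
exists u_, f_; split.
- by move=> n; have [] := hu n.
- by move=> n; have [] := hu n.
- move=> n; rewrite -lee_fin; apply: le_trans (fL n).
  rewrite /Rintegral fineK //; apply: integrable_fin_num => //.
  exact: (integrable_norm (intf n)).
- by move=> n; have [_ _ /le_trans] := hu n; apply.
move=> t /andP[t0 tT].
have -> : u `]0, t]%classic = (up `]0%R, t]%classic - un `]0%R, t]%classic)%E.
  by rewrite (jordan_decomp uPN) // /cadd /= cscaleN1.
have unfin : (- un `]0%R, t]%classic)%E \is a fin_num.
  by rewrite fin_numN fin_num_measure.
have h : ((\int[leb]_(s in `]0%R, t]) (smear up n s)%:E) -
    (\int[leb]_(s in `]0%R, t]) (smear un n s)%:E))%E @[n --> \oo] -->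
    (up `]0%R, t]%classic - un `]0%R, t]%classic)%E.
  by apply: cvgeB; [exact: fin_num_adde_defl|exact: smear_cvg|exact: smear_cvg].
apply: cvg_trans h; apply: near_eq_cvg; apply: nearW => n /=.
have [_ [_ uE] _] := hu n; rewrite uE //; last first.
  by apply: subset_itv; rewrite bnd_simp.
by rewrite -integralB_EFin //; exact: integrable_smear.
Qed.

End ControlApproximation.

(** * Galerkin estimates *)

Section WeakIntegral.
Context {R : realType} {H : completeNormedModType R[i]}.
Variable ip : H -> H -> R[i].
Hypothesis ipP : is_inner_product ip.
Variable phi : nat -> H.
Local Notation leb := (@lebesgue_measure R).
Implicit Types (D : set (measurableTypeR R)) (f : R -> H) (v w : H).

Lemma ip_ext v w : (forall chi, ip chi v = ip chi w) -> v = w.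
Proof.
move=> vw; apply/eqP; rewrite -subr_eq0; apply/eqP; apply: nrm_eq0.
apply/eqP; rewrite -sqrf_eq0; apply/eqP; apply: complexI.
by rewrite -(ipxx ipP) ipBr // vw subrr.
Qed.

Lemma eq_is_integral D f1 f2 v : measurable D -> (forall t, D t -> f1 t = f2 t) ->
  is_integral ip D f1 v -> is_integral ip D f2 v.
Proof.
move=> mD f12 h chi; have [i1 i2 e] := h chi; split.
- by apply: (eq_integrable mD _ _ _ i1) => // t /set_mem Dt; rewrite /= f12.
- by apply: (eq_integrable mD _ _ _ i2) => // t /set_mem Dt; rewrite /= f12.
- by rewrite e; congr (_ +i* _); apply: eq_Rintegral => t /set_mem Dt; rewrite f12.
Qed.

Lemma is_integralB D f1 f2 v1 v2 : measurable D ->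
  is_integral ip D f1 v1 -> is_integral ip D f2 v2 ->
  is_integral ip D (fun t => f1 t - f2 t) (v1 - v2).
Proof.
move=> mD h1 h2 chi; have [i1 j1 e1] := h1 chi; have [i2 j2 e2] := h2 chi.
have Re_e : (fun t => complex.Re (ip chi (f1 t - f2 t))) =
    (fun t => complex.Re (ip chi (f1 t)) - complex.Re (ip chi (f2 t))).
  by apply/funext => t; rewrite ipBr // ReD ReN.
have Im_e : (fun t => complex.Im (ip chi (f1 t - f2 t))) =
    (fun t => complex.Im (ip chi (f1 t)) - complex.Im (ip chi (f2 t))).
  by apply/funext => t; rewrite ipBr // ImD ImN.
split.
- by rewrite Re_e; exact: (integrableB mD i1 i2).
- by rewrite Im_e; exact: (integrableB mD j1 j2).
- rewrite ipBr // e1 e2 Re_e Im_e !RintegralB //.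
Qed.

(** The diagonal operator is moved onto the test vector through its adjoint, whose coefficients are
    the conjugates. *)
Lemma is_integral_diag D f v (g : nat -> R[i]) N : is_integral ip D f v ->
  is_integral ip D (fun t => diag ip phi g N (f t)) (diag ip phi g N v).
Proof.
move=> h chi; have := h (diag ip phi (fun j => (g j)^*) N chi).
have adj w : ip (diag ip phi (fun j => (g j)^*) N chi) w =
    ip chi (diag ip phi g N w).
  by rewrite ip_diagl //; congr (ip chi _); apply: eq_diag => j _; rewrite conjcK.
rewrite adj; case=> i1 i2 e.
split; [by under eq_fun do rewrite -adj|by under eq_fun do rewrite -adj|].
by rewrite e; congr (_ +i* _); apply: eq_Rintegral => t _; rewrite adj.
Qed.

Lemma is_integral_unique D f v w :
  is_integral ip D f v -> is_integral ip D f w -> v = w.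
Proof.
move=> hv hw; apply: ip_ext => chi.
by have [_ _ ->] := hv chi; have [_ _ ->] := hw chi.
Qed.

(** Testing the weak integral against [v] itself gives |v|^2 = int Re <v, f> <= |v| int G. *)
Lemma nrm_integral_le D f v (G : R -> R) : measurable D ->
  is_integral ip D f v -> leb.-integrable D (EFin \o G) ->
  (forall t, D t -> nrm (f t) <= G t) -> nrm v <= \int[leb]_(t in D) G t.
Proof.
move=> mD hv iG fG.
have G0 : 0 <= \int[leb]_(t in D) G t.
  by apply: Rintegral_ge0 => t Dt; apply: le_trans (fG t Dt); exact: nrm_ge0.
apply: (nrm_le_Re_ip ipP G0); have [i1 _ ->] := hv v => /=.
rewrite -RintegralZl //; apply: le_Rintegral => //.
  exact: (integrableZl mD (nrm v) iG).
move=> t Dt; apply: le_trans (ler_norm _) _.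
apply: le_trans (ler_Re_ip ipP _ _) _; rewrite ler_wpM2l ?nrm_ge0 //.
exact: fG.
Qed.

End WeakIntegral.

(** * Gronwall bounds for controls with integrable density *)

Section GalerkinEstimates.
Context {R : realType} {H : completeNormedModType R[i]}.
Variable ip : H -> H -> R[i].
Hypothesis ipP : is_inner_product ip.
Variable phi : nat -> H.
Hypothesis phiP :
  forall i j, ip (phi i) (phi j) = ((i == j) && (phi i != 0))%:R.
Variables (DA : set H) (A B : H -> H).
Hypothesis skewA : skew_adjoint ip DA A.
Hypothesis eigenA : made_of_eigenvectors DA A phi.
Local Notation leb := (@lebesgue_measure R).
Local Notation proj := (diag ip phi (fun=> 1)).
Local Notation E := (exp_op ip phi A).
Implicit Types (N : nat) (T : R) (f : R -> R) (v w : H).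
Implicit Types (g : nat -> R[i]).

Definition galerkin_mild N := mild_solution ip
  (fun j => if (j < N)%N then phi j else 0)
  (galerkin_proj ip phi N \o A) (galerkin_proj ip phi N \o B).

(** The constant may grow with [N]: it serves for continuity and for passing to limits at a fixed
    truncation. *)
Lemma diag_lipschitz g N : exists2 c, 0 <= c &
  forall v, nrm (diag ip phi g N v) <= c * nrm v.
Proof.
exists (\sum_(j < N) cmod (g j)).
  by apply: sumr_ge0 => j _; exact: cmod_ge0.
move=> v; set c := \sum_(j < N) _.
have c0 : 0 <= c by apply: sumr_ge0 => j _; exact: cmod_ge0.
apply: (@le_trans _ _ (nrm (diag ip phi (fun=> c%:C * 1) N v))).
  apply: le_diag => // j jN; rewrite mulr1 cmod_realC ger0_norm //.
  rewrite /c (bigD1 (Ordinal jN)) //= lerDl.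
  by apply: sumr_ge0 => i _; exact: cmod_ge0.
rewrite diag_scale // nrmZ cmod_realC ger0_norm // ler_wpM2l //.
exact: nrm_proj_le.
Qed.

Lemma lipschitz_within (p : H -> R) (c T : R) (y : R -> H) :
  0 <= c -> (forall v w, `|p v - p w| <= c * nrm (v - w)) ->
  {within `[0, T], continuous y} -> {within `[0, T], continuous (p \o y)}.
Proof.
move=> c0 hp cy t; apply: (cvg_comp _ _ (cy t)).
apply/cvgrPdist_lt => e e0.
have c1 : 0 < c + 1 by rewrite ltr_wpDl.
have := @cvg_id _ (nbhs (y t)) => /cvg_nrmP /(_ (e / (c + 1)) (divr_gt0 e0 c1)).
apply: filterS => v; rewrite ltr_pdivlMr // mulrC.
apply: le_lt_trans; apply: le_trans (hp _ _) _.
by rewrite ler_wpM2r ?nrm_ge0 // lerDl.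
Qed.

Lemma nrm_diag_within g N T (y : R -> H) : {within `[0, T], continuous y} ->
  {within `[0, T], continuous (fun t => nrm (diag ip phi g N (y t)))}.
Proof.
have [c c0 hc] := diag_lipschitz g N.
apply: (@lipschitz_within (fun v => nrm (diag ip phi g N v)) c) => // v w.
by apply: le_trans (ler_dist_nrm _ _) _; rewrite -diagB.
Qed.

Lemma diag_phase_nrm g N t v :
  nrm (diag ip phi g N (diag ip phi (phase ip phi A t) N v)) <=
  nrm (diag ip phi g N v).
Proof.
rewrite diag_diag //; apply: le_diag => // j _.
by rewrite cmodM (cmod_phase ipP skewA eigenA) mulr1.
Qed.

Lemma proj_phase N t v :
  proj N (diag ip phi (phase ip phi A t) N v) = diag ip phi (phase ip phi A t) N v.
Proof. by rewrite diag_diag //; apply: eq_diag => j _; rewrite mul1r. Qed.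

Lemma proj_idem N v : proj N (proj N v) = proj N v.
Proof. by rewrite diag_diag //; apply: eq_diag => j _; rewrite mul1r. Qed.

Lemma galerkin_mildE N T f y0 y t : galerkin_mild N T f y0 y -> 0 <= t <= T ->
  is_integral ip `]0, t]
    (fun s => (f s)%:C *: diag ip phi (phase ip phi A (t - s)) N (proj N (B (y s))))
    (y t - diag ip phi (phase ip phi A t) N y0).
Proof.
case=> _ h /h; rewrite exp_op_galerkin //; apply: eq_is_integral => // s _.
by rewrite exp_op_galerkin // /= diag1.
Qed.

(** Projecting the mild equation leaves its integrand unchanged, and a weak integral is unique; so
    the solution equals its projection. *)
Lemma galerkin_stays N T f y0 y t : galerkin_mild N T f y0 y -> 0 <= t <= T ->
  proj N (y t) = y t.
Proof.
move=> my tT; have h := galerkin_mildE my tT.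
have h' := is_integral_diag ipP phi (fun=> 1) N h.
have := is_integral_unique ipP _ h.
move=> /(_ (proj N (y t - diag ip phi (phase ip phi A t) N y0))).
rewrite diagB // proj_phase => e.
apply: (addIr (- diag ip phi (phase ip phi A t) N y0)); rewrite e //.
move: h'; rewrite diagB // proj_phase; apply: eq_is_integral => // s _.
by rewrite diagZ // proj_phase.
Qed.

(** The phases commute with [g] and have modulus 1, so Gronwall with weight C |f| applies in the
    norm weighted by [g]. The constant is chosen before [g], [N], [T] and [f]; it is used for the
    norm of H and for that of order k/2. *)
Lemma galerkin_bound (C L : R) : 0 <= C -> 0 <= L -> exists2 K, 0 <= K &
  forall g N T f y0 y,
  (forall v, proj N v = v ->
     nrm (diag ip phi g N (B v)) <= C * nrm (diag ip phi g N v)) ->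
  leb.-integrable `]0, T] (EFin \o f) ->
  \int[leb]_(s in `]0, T]) `|f s| <= L ->
  galerkin_mild N T f y0 y ->
  forall t, 0 <= t <= T ->
    nrm (diag ip phi g N (y t)) <= K * nrm (diag ip phi g N y0).
Proof.
move=> C0 L0; have [K K0 hK] := gronwall (mulr_ge0 C0 L0).
exists K => // g N T f y0 y hB intf fL my.
have mI (t : R) : measurable (`]0, t]%classic : set (measurableTypeR R)).
  exact: measurable_itv.
pose w s := C * `|f s|.
have iw : leb.-integrable `]0, T] (EFin \o w).
  exact: (integrableZl (mI T) C (integrable_norm intf)).
pose h t := nrm (diag ip phi g N (y t)).
have ch : {within `[0, T], continuous h} by apply: nrm_diag_within; case: my.
apply: (hK T w h _ iw) => //.
- by move=> s; rewrite mulr_ge0.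
- rewrite RintegralZl //; last exact: (integrable_norm intf).
  by rewrite ler_wpM2l.
- by move=> t; exact: nrm_ge0.
- exact: nrm_ge0.
move=> t /[dup] tT /andP[t0 tT'].
have hi := is_integral_diag ipP phi g N (galerkin_mildE my tT).
have -> : h t = nrm (diag ip phi g N (diag ip phi (phase ip phi A t) N y0) +
    diag ip phi g N (y t - diag ip phi (phase ip phi A t) N y0)).
  by rewrite -diagD // addrC subrK.
apply: le_trans (ler_nrmD _ _) _; apply: lerD; first exact: diag_phase_nrm.
apply: (nrm_integral_le ipP _ hi) => //.
  apply: integrableS (integrable_weight iw ch) => //.
  by apply: subset_itv; rewrite bnd_simp.
move=> s /=; rewrite in_itv /= => /andP[s0 st].
rewrite diagZ // nrmZ cmod_realC /w mulrAC [leLHS]mulrC ler_wpM2r //.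
apply: le_trans (diag_phase_nrm _ _ _ _) _.
apply: le_trans (hB _ (galerkin_stays my _)); last first.
  by rewrite ltW // (le_trans st).
by rewrite diag_diag //; apply: le_diag => // j _; rewrite mulr1.
Qed.

Lemma galerkin_error (C L : R) : 0 <= C -> 0 <= L ->
  (forall v w, B (v - w) = B v - B w) -> (forall v, nrm (B v) <= C * nrm v) ->
  exists2 K, 0 <= K & forall N T f x0 x y (d : R),
  leb.-integrable `]0, T] (EFin \o f) ->
  \int[leb]_(s in `]0, T]) `|f s| <= L -> 0 <= d ->
  mild_solution ip phi A B T f x0 x ->
  galerkin_mild N T f (proj N x0) y ->
  (forall t, 0 <= t <= T -> nrm (B (y t) - proj N (B (y t))) <= d) ->
  forall t, 0 <= t <= T ->
    nrm (x t - y t) <= K * (nrm (x0 - proj N x0) + L * d).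
Proof.
move=> C0 L0 BB CB; have [K K0 hK] := gronwall (mulr_ge0 C0 L0).
exists K => // N T f x0 x y d intf fL d0 [cx mx] my hd.
have mI (t : R) : measurable (`]0, t]%classic : set (measurableTypeR R)).
  exact: measurable_itv.
pose w s := C * `|f s|.
have ifn : leb.-integrable `]0, T] (EFin \o (fun s => `|f s|)).
  exact: (integrable_norm intf).
have iw : leb.-integrable `]0, T] (EFin \o w).
  exact: (integrableZl (mI T) C ifn).
pose h t := nrm (x t - y t).
have ch : {within `[0, T], continuous h}.
  apply: (@lipschitz_within (fun v => nrm v) 1 T (fun t => x t - y t)) => //.
    by move=> v u; rewrite mul1r; exact: ler_dist_nrm.
  by move=> t; apply: cvgB; [exact: cx|case: my => cy _; exact: cy].
apply: (hK T w h _ iw) => //.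
- by move=> s; rewrite mulr_ge0.
- by rewrite RintegralZl // ler_wpM2l.
- by move=> t; exact: nrm_ge0.
- by rewrite addr_ge0 ?nrm_ge0 // mulr_ge0.
move=> t /[dup] tT /andP[t0 tT'].
have hx := mx t tT; have hy := galerkin_mildE my tT.
have hz := is_integralB ipP (mI t) hx hy.
have Efin r v : diag ip phi (phase ip phi A r) N (proj N v) = E r (proj N v).
  by rewrite (exp_op_fin ipP phiP skewA eigenA r (proj_idem N v)).
have EB := exp_opB ipP phiP skewA eigenA.
have En := nrm_exp_op ipP phiP skewA eigenA.
(* The error is e^(tA) applied to the truncated part of the initial datum, plus the difference of
   the two Duhamel integrals. *)
have -> : h t = nrm (E t (x0 - proj N x0) + (x t - E t x0 -
    (y t - diag ip phi (phase ip phi A t) N (proj N x0)))).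
  rewrite /h Efin EB; congr nrm.
  by rewrite opprB addrCA [E t x0 - _ + _]addrA subrK addrA subrK.
apply: le_trans (ler_nrmD _ _) _; rewrite -[leRHS]addrA; apply: lerD; first exact: En.
have iS (q : R -> R) : leb.-integrable `]0, T] (EFin \o q) ->
    leb.-integrable `]0, t] (EFin \o q).
  by apply: integrableS => //; apply: subset_itv; rewrite bnd_simp.
have iwh := iS _ (integrable_weight iw ch).
have ifd : leb.-integrable `]0, T] (EFin \o (fun s => `|f s| * d)).
  apply: (eq_integrable _ _ _ _ (integrableZl (mI T) d ifn)) => //.
  by move=> s _ /=; rewrite mulrC.
apply: (@le_trans _ _ (\int[leb]_(s in `]0, t]) (`|f s| * d + w s * h s))).
  apply: (nrm_integral_le ipP _ hz) => //.
    exact: (integrableD (mI t) (iS _ ifd) iwh).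
  move=> s /=; rewrite in_itv /= => /andP[s0 st].
  have sT : 0 <= s <= T by rewrite ltW // (le_trans st).
  rewrite Efin -scalerBr nrmZ cmod_realC /w mulrAC [_ * h s * _]mulrC -mulrDr.
  rewrite ler_wpM2l // -EB; apply: le_trans (En _ _) _.
  (* B x - pi_N B y = (1 - pi_N) B y + B (x - y): a source of size [d], and a term for Gronwall. *)
  rewrite -(subrK (B (y s)) (B (x s))) -addrA -BB addrC.
  by apply: le_trans (ler_nrmD _ _) _; apply: lerD; [exact: hd|exact: CB].
rewrite RintegralD //; last exact: iS.
apply: lerD => //; rewrite RintegralZr //; last exact: iS.
rewrite ler_wpM2r //; apply: le_trans fL.
rewrite -[leRHS](subrK (\int[leb]_(s in `]0, t]) `|f s|)) lerDr.
by rewrite Rintegral_itvB ?bnd_simp // Rintegral_ge0.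
Qed.

End GalerkinEstimates.

(** * Interpolation, passage to measures, and conclusion *)

Section Assembly.
Context {R : realType} {H : completeNormedModType R[i]}.
Variable ip : H -> H -> R[i].
Hypothesis ipP : is_inner_product ip.
Variable phi : nat -> H.
Hypothesis phiP :
  forall i j, ip (phi i) (phi j) = ((i == j) && (phi i != 0))%:R.
Hypothesis phi_dense : dense [set v | exists N, galerkin_space phi N v].
Variables (DA : set H) (A B : H -> H).
Hypothesis skewA : skew_adjoint ip DA A.
Hypothesis eigenA : made_of_eigenvectors DA A phi.
Local Notation leb := (@lebesgue_measure R).
Local Notation proj := (diag ip phi (fun=> 1)).
Local Notation W a := (diag ip phi (abs_weight ip phi A a)).
Implicit Types (a b M L : R) (m N : nat) (v w z : H).

(** Mode by mode, x^b <= r^b + r^(-(a - b)) x^a, according to whether x <= r. First [r] makes the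
    second term contribute at most eps / 2, then [e] does the same for the first. *)
Lemma interpolation a b M (eps : R) : 0 <= b < a -> 0 <= M -> 0 < eps ->
  exists2 e, 0 < e & forall z, nrm z <= e -> (forall m, nrm (W a m z) <= M) ->
    forall m, nrm (W b m z) <= eps.
Proof.
move=> /andP[b0 ba] M0 eps0.
have ab0 : 0 < a - b by rewrite subr_gt0.
have [r r1 hr] := powR_unbounded (2 * M / eps) ab0.
have r0 : 0 < r := lt_le_trans ltr01 r1.
have rb0 : 0 < r `^ b by rewrite powR_gt0.
have rab0 : 0 < r `^ (a - b) by rewrite powR_gt0.
exists (eps / (2 * r `^ b)); first by rewrite divr_gt0 // mulr_gt0.
move=> z ze zM m; pose c := (r `^ (a - b))^-1.
have c0 : 0 <= c by rewrite invr_ge0 ltW.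
have key x : 0 <= x -> x `^ b <= r `^ b + c * x `^ a.
  move=> x0; have [xr|rx] := leP x r.
    apply: le_trans (_ : r `^ b <= _); last by rewrite lerDl mulr_ge0 ?powR_ge0.
    by rewrite ge0_ler_powR ?nnegrE // ltW.
  have x_gt0 : 0 < x := lt_trans r0 rx.
  rewrite ler_wpDl ?powR_ge0 // /c ler_pdivlMl //.
  have -> : x `^ a = x `^ (a - b) * x `^ b.
    by rewrite -powRD ?subrK // (gt_eqF x_gt0) implybT.
  by rewrite ler_wpM2r ?powR_ge0 // ge0_ler_powR ?nnegrE // ltW.
have -> : eps = r `^ b * (eps / (2 * r `^ b)) + eps / 2.
  by field; rewrite gt_eqF.
apply: (@le_trans _ _ (nrm ((r `^ b)%:C *: proj m z + c%:C *: W a m z))).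
  rewrite -!diag_scale // -diag_add; apply: le_diag => // j _.
  rewrite mulr1 /abs_weight /abs_pow -rmorphM -rmorphD.
  rewrite !cmod_realC !ger0_norm ?powR_ge0 // ?addr_ge0 ?mulr_ge0 ?powR_ge0 //.
  exact: key (cmod_ge0 _).
apply: le_trans (ler_nrmD _ _) _; rewrite !nrmZ !cmod_realC !ger0_norm ?powR_ge0 //.
apply: lerD.
  rewrite ler_wpM2l ?powR_ge0 //; exact: le_trans (nrm_proj_le ipP phiP _ _) ze.
apply: le_trans (ler_wpM2l c0 (zM m)) _.
rewrite /c ler_pdivrMl //; move: hr; rewrite ler_pdivrMr //; lra.
Qed.

Lemma fin_weight a m N v : proj N v = v -> nrm (W a m v) <= nrm (W a N v).
Proof.
move=> vN; have [mN|Nm] := leqP m N; first exact: le_diag.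
by rewrite -{1}vN diag_diag ?(ltnW Nm) //; apply: le_diag => // j _; rewrite mulr1.
Qed.

(** A vector of the Galerkin space lies in D(|A|^a), with norm at most that of its truncation at
    [N]; truncating B v only decreases its norm. So the constant of B is kept, whatever [N]. *)
Lemma bounded_on_galerkin a C N v : proj N v = v ->
  (forall w, dom_abs_pow ip phi A a w -> dom_abs_pow ip phi A a (B w)) ->
  (forall w, dom_abs_pow ip phi A a w ->
    norm_abs_pow ip phi A a (B w) <= C * norm_abs_pow ip phi A a w) ->
  0 <= C -> nrm (W a N (B v)) <= C * nrm (W a N v).
Proof.
move=> vN domB hC C0.
have [dv nv] := dom_abs_pow_bound ipP phiP (fun m => fin_weight a m vN).
apply: le_trans (le_norm_abs_pow ipP phiP N (domB v dv)) _.
by apply: le_trans (hC v dv) _; rewrite ler_wpM2l.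
Qed.

Lemma cvg_lipschitz_le (p : H -> R) (c M : R) (v_ : nat -> H) v : 0 <= c ->
  (forall w z, `|p w - p z| <= c * nrm (w - z)) ->
  v_ n @[n --> \oo] --> v -> (forall n, p (v_ n) <= M) -> p v <= M.
Proof.
move=> c0 hp vv pM; apply/ler_addgt0Pr => e e0.
have c1 : 0 < c + 1 by rewrite ltr_wpDl.
have /cvg_nrmP/(_ (e / (c + 1)) (divr_gt0 e0 c1))[n _ hn] := vv.
have := hn n (leqnn n); rewrite ltr_pdivlMr // => /ltW he.
have := le_trans (ler_norm _) (hp v (v_ n)); have := pM n.
have := nrm_ge0 (v - v_ n); nra.
Qed.

Lemma nrm_diag_dist g m v w :
  `|nrm (diag ip phi g m v) - nrm (diag ip phi g m w)| <=
  nrm (diag ip phi g m (v - w)).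
Proof. by rewrite diagB //; exact: ler_dist_nrm. Qed.

Lemma galerkin_approximation (k CW s eps L : R) v
    (Upsilon : R -> {charge set R -> \bar R} -> R -> H -> H)
    (X : nat -> R -> {charge set R -> \bar R} -> R -> H -> H) :
  skew_adjoint ip setT B -> bounded_operator B ->
  (forall w, dom_abs_pow ip phi A (k / 2) w -> dom_abs_pow ip phi A (k / 2) (B w)) ->
  (forall w, dom_abs_pow ip phi A (k / 2) w ->
    norm_abs_pow ip phi A (k / 2) (B w) <= CW * norm_abs_pow ip phi A (k / 2) w) ->
  compact_operator (B \o op_inv DA (fun x => x - A x)) ->
  0 < k -> is_propagator ip setT phi A B Upsilon ->
  (forall N, is_galerkin_propagator ip phi A B N (X N)) ->
  0 <= s -> s < k -> 0 < eps -> 0 <= L -> dom_abs_pow ip phi A (k / 2) v ->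
  exists N0, forall N, (N0 <= N)%N ->
    forall T (u : {charge set R -> \bar R}), 0 < T -> control T u ->
    (charge_abs u `]0%R, T] < L%:E)%E -> forall t, 0 <= t <= T ->
    let err := Upsilon T u t v - X N T u t (galerkin_proj ip phi N v) in
    dom_abs_pow ip phi A (s / 2) err /\ norm_abs_pow ip phi A (s / 2) err < eps.
Proof.
move=> skewB bndB domB hCW cptB k0 propU propX s0 sk eps0 L0 dv.
pose a := k / 2.
have a0 : 0 < a by rewrite divr_gt0.
have BB w z : B (w - z) = B w - B z.
  have [[_ linB] _ _] := skewB.
  by have [_] := linB (-1) z w I I; rewrite !scaleN1r addrC => ->; rewrite addrC.
have [CB hCB] := bndB.
(* One nonnegative constant for B in both norms, so that a single Gronwall constant serves for
   both. *)
pose C := Num.max (Num.max CB CW) 0.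
have C0 : 0 <= C by rewrite le_max lexx orbT.
have hC w : nrm (B w) <= C * nrm w.
  by apply: le_trans (hCB w) _; rewrite ler_wpM2r ?nrm_ge0 // !le_max lexx.
have hCa w : dom_abs_pow ip phi A a w ->
    norm_abs_pow ip phi A a (B w) <= C * norm_abs_pow ip phi A a w.
  move=> dw; apply: le_trans (hCW w dw) _.
  by rewrite ler_wpM2r ?nrm_ge0 // !le_max lexx orbT.
have [K1 K10 bound] := galerkin_bound ipP phiP B skewA eigenA C0 L0.
have [K2 K20 error] := galerkin_error ipP phiP skewA eigenA C0 L0 BB hC.
pose M0 := Num.max (nrm v) (norm_abs_pow ip phi A a v).
pose M := K1 * M0.
have M0_ge0 : 0 <= M by rewrite mulr_ge0 // le_max nrm_ge0.
have gmild N T u f : 0 < T -> control T u -> has_L1_density T f u ->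
    galerkin_mild ip phi A B N T f (proj N v)
      (fun t => X N T u t (galerkin_proj ip phi N v)).
  move=> T0 cu fu; have [h _] := propX N; rewrite diag1; apply: h => //.
  by rewrite -diag1; exact: diag_galerkin.
pose y N T u t := X N T u t (galerkin_proj ip phi N v).
have yn N T u f t : 0 < T -> control T u -> has_L1_density T f u ->
    \int[leb]_(x in `]0, T]) `|f x| <= L -> 0 <= t <= T ->
    [/\ proj N (y N T u t) = y N T u t, nrm (y N T u t) <= M &
      forall m, nrm (W a m (y N T u t)) <= M].
  move=> T0 cu fu fL tT; have my := gmild N T u f T0 cu fu.
  have yN := galerkin_stays ipP phiP my tT; split=> //.
    rewrite -/(y N T u t) in yN; rewrite -yN.
    apply: le_trans (bound _ _ _ _ _ _ _ fu.1 fL my t tT) _.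
      by move=> w wN; rewrite wN; apply: le_trans (nrm_proj_le ipP phiP _ _) (hC w).
    rewrite ler_wpM2l // proj_idem // le_max nrm_proj_le //.
  move=> m; apply: le_trans (fin_weight a m yN) _.
  apply: le_trans (bound _ _ _ _ _ _ _ fu.1 fL my t tT) _.
    by move=> w wN; exact: bounded_on_galerkin.
  rewrite ler_wpM2l // diag_diag // le_max.
  apply/orP; right; apply: le_trans (le_norm_abs_pow ipP phiP N dv).
  by apply: le_diag => // j _; rewrite mulr1.
(* For fixed [m] the truncated weighted norm is continuous on H, so the bound passes from densities
   to measures. *)
have y_bound N T u t m : 0 < T -> control T u ->
    (charge_abs u `]0%R, T] < L%:E)%E -> 0 <= t <= T -> nrm (W a m (y N T u t)) <= M.
  move=> T0 cu uL tT.
  have [u_ [f_ [cu_ fu_ fL bu_ lu]]] := control_approx T0 cu (ltW uL).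
  have [_ cvgX] := propX N.
  have [c c0 hc] := diag_lipschitz ipP phiP (abs_weight ip phi A a) m.
  apply: (@cvg_lipschitz_le (fun w => nrm (W a m w)) c M
    (fun i => y N T (u_ i) t)) => //.
  - by move=> w z; apply: le_trans (nrm_diag_dist _ _ _ _) (hc _).
  - apply: cvgX => //; [by move=> i; split => //; exists (f_ i)|by exists L|].
    by rewrite -diag1; exact: diag_galerkin.
  - by move=> i; have [] := yn N T _ _ t T0 (cu_ i) (fu_ i) (fL i) tT.
have small e : 0 < e -> exists N0, forall N, (N0 <= N)%N ->
    forall T (u : {charge set R -> \bar R}), 0 < T -> control T u ->
    (charge_abs u `]0%R, T] < L%:E)%E -> forall t, 0 <= t <= T ->
    nrm (Upsilon T u t v - y N T u t) <= e.
  move=> e0.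
  have K2p : 0 < K2 + 1 by rewrite ltr_wpDl.
  have Lp : 0 < L + 1 by rewrite ltr_wpDl.
  (* With gap <= g and L d <= g, the error K2 (gap + L d) is at most 2 K2 g <= e. Adding 1 to [K2]
     and [L] avoids dividing by 0. *)
  pose g := e / (2 * (K2 + 1)); pose d := g / (L + 1).
  have g0 : 0 < g by rewrite divr_gt0 // mulr_gt0.
  have d0 : 0 < d by rewrite divr_gt0.
  have [N1 hN1] := tail_small ipP phiP skewA eigenA M phi_dense skewB bndB cptB a0 d0.
  have /cvg_nrmP/(_ g g0)[N2 _ hN2] := @proj_cvg _ _ _ ipP _ phiP v phi_dense.
  exists (maxn N1 N2) => N; rewrite geq_max => /andP[NN1 NN2] T u T0 cu uL t tT.
  have gap : nrm (v - proj N v) <= g by apply/ltW/hN2.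
  have [u_ [f_ [cu_ fu_ fL bu_ lu]]] := control_approx T0 cu (ltW uL).
  have [mU cvgU] := propU; have [_ cvgX] := propX N.
  apply: (@cvg_lipschitz_le (fun w => nrm w) 1 e
    (fun i => Upsilon T (u_ i) t v - y N T (u_ i) t)) => //.
  - by move=> w z; rewrite mul1r; exact: ler_dist_nrm.
  - apply: cvgB; [apply: cvgU|apply: cvgX] => //;
      try by [move=> i; split => //; exists (f_ i)|exists L].
    by rewrite -diag1; exact: diag_galerkin.
  move=> i; have my := gmild N T (u_ i) (f_ i) T0 (cu_ i) (fu_ i).
  have mx := mU T (u_ i) (f_ i) v T0 (cu_ i) (fu_ i) I.
  apply: le_trans (error _ _ _ _ _ _ d (fu_ i).1 (fL i) (ltW d0) mx my _ t tT) _.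
    move=> r rT; have [yN yM yaM] := yn N T _ _ r T0 (cu_ i) (fu_ i) (fL i) rT.
    exact: (hN1 N NN1 N _ yN yM (yaM N)).
  have Ld : L * d <= g.
    by rewrite /d mulrA ler_pdivrMr // mulrC ler_wpM2l ?(ltW g0) // lerDl.
  apply: (@le_trans _ _ (K2 * (g + g))); first by rewrite ler_wpM2l // lerD.
  have -> : e = (K2 + 1) * (g + g) by rewrite /g; field; rewrite gt_eqF.
  by rewrite ler_wpM2r ?addr_ge0 ?(ltW g0) // lerDl.
(* Again for fixed [m], Upsilon is a limit of Galerkin solutions by [small], and inherits their
   bound, which does not depend on [N]. *)
have x_bound T u t m : 0 < T -> control T u ->
    (charge_abs u `]0%R, T] < L%:E)%E -> 0 <= t <= T ->
    nrm (W a m (Upsilon T u t v)) <= M.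
  move=> T0 cu uL tT; apply/ler_addgt0Pr => e e0.
  have [c c0 hc] := diag_lipschitz ipP phiP (abs_weight ip phi A a) m.
  have c1 : 0 < c + 1 by rewrite ltr_wpDl.
  have [N hN] := small (e / (c + 1)) (divr_gt0 e0 c1).
  have := hN N (leqnn N) T u T0 cu uL t tT; rewrite ler_pdivlMr // => xy.
  have := y_bound N T u t m T0 cu uL tT.
  have := le_trans (ler_norm _) (nrm_diag_dist (abs_weight ip phi A a) m
    (Upsilon T u t v) (y N T u t)).
  have := hc (Upsilon T u t v - y N T u t).
  have := nrm_ge0 (Upsilon T u t v - y N T u t); nra.
(* The error is at most 2 M in the norm of order k/2; aiming at eps / 2 gives a strict inequality in
   the end. *)
have [||| e e0 he] := @interpolation a (s / 2) (2 * M) (eps / 2).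
- by rewrite divr_ge0 // /a ltr_pM2r.
- by rewrite mulr_ge0.
- by rewrite divr_gt0.
have [N0 hN0] := small e e0.
exists N0 => N NN0 T u T0 cu uL t tT err.
have [|] := @dom_abs_pow_bound _ _ _ ipP _ phiP A (s / 2) err (eps / 2).
  apply: he; first exact: hN0.
  move=> m; rewrite /err diagB //; apply: le_trans (ler_nrmB _ _) _.
  rewrite mulr_natl mulr2n; apply: lerD; first exact: x_bound.
  exact: y_bound.
move=> derr nerr; split=> //; apply: le_lt_trans nerr _.
by rewrite ltr_pdivrMr // ltr_pMr // ltr1n.
Qed.

End Assembly.

Theorem theorem4 (R : realType) (H : completeNormedModType R[i])
    (ip : H -> H -> R[i]) (k : R) (DA : set H) (A : H -> H) (phi : nat -> H)
    (B : H -> H)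
    (Upsilon : R -> {charge set R -> \bar R} -> R -> H -> H)
    (X : nat -> R -> {charge set R -> \bar R} -> R -> H -> H) (s : R) :
  is_inner_product ip ->
  @separable_space R H ->
  0 < k ->
  skew_adjoint ip DA A ->
  invertible_with_bounded_inverse DA A ->
  hilbert_basis ip phi ->
  made_of_eigenvectors DA A phi ->
  skew_adjoint ip setT B ->
  bounded_operator B ->
  bounded_on_dom_abs_pow ip phi A (k / 2) B ->
  compact_operator (B \o op_inv DA (fun x => x - A x)) ->
  is_propagator ip setT phi A B Upsilon ->
  (forall N, is_galerkin_propagator ip phi A B N (X N)) ->
  0 <= s -> s < k ->
  forall (eps L : R) (n : nat) (psi : 'I_n -> H),
    0 < eps -> 0 <= L ->
    (forall j, dom_abs_pow ip phi A (k / 2) (psi j)) ->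
    exists N : nat, (0 < N)%N /\
      forall (T : R) (u : {charge set R -> \bar R}),
        0 < T -> control T u ->
        (charge_abs u `]0%R, T] < L%:E)%E ->
        forall (t : R) (j : 'I_n), 0 <= t <= T ->
          let err := Upsilon T u t (psi j)
                     - X N T u t (galerkin_proj ip phi N (psi j)) in
          dom_abs_pow ip phi A (s / 2) err /\
          norm_abs_pow ip phi A (s / 2) err < eps.
Proof.
move=> ipP _ k0 skewA _ [phiP _ phiD] eigenA skewB bndB [domB [CW hCW]] cptB.
move=> propU propX s0 sk eps L n psi eps0 L0 dpsi.
(* Each vector gets a threshold beyond which every rank works, so the maximum of the thresholds
   serves for all of them; the successor makes it positive. *)
suff /choice[N0 hN0] : forall j, exists N0, forall N, (N0 <= N)%N ->
    forall (T : R) (u : {charge set R -> \bar R}), 0 < T -> control T u ->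
    (charge_abs u `]0%R, T] < L%:E)%E -> forall t, 0 <= t <= T ->
    let err := Upsilon T u t (psi j) - X N T u t (galerkin_proj ip phi N (psi j)) in
    dom_abs_pow ip phi A (s / 2) err /\ norm_abs_pow ip phi A (s / 2) err < eps.
  exists (\max_j N0 j).+1; split=> // T u T0 cu uL t j tT.
  by apply: hN0 => //; rewrite leqW // leq_bigmax.
move=> j; move: (psi j) (dpsi j) => v dv {psi dpsi j n}.
exact: (galerkin_approximation ipP phiP phiD skewA eigenA skewB bndB domB hCW
  cptB k0 propU propX s0 sk eps0 L0 dv).
Qed.
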